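(* Let $\mathcal{E}$ be a Hilbert space, and let $k:\mathbb{D}\times\mathbb{D}\to\mathcal{B}(\mathcal{E})$ be an analytic kernel. Suppose the shift $M_z$ is left-invertible on $\mathcal{H}_k$. Put $$L=|M_z|^{1/2}\big((L_{M_z}|M_z|M_z)^{-1}L_{M_z}\big)|M_z|^{1/2},\qquad \tilde{\mathcal{W}}=\ker\tilde M_z^*=|M_z|^{-1/2}\ker M_z^*,$$ and $\Omega=\{z\in\mathbb{C}:|z|<1/r(L)\}$, where $r(L)$ is the spectral radius of $L$. Then the Aluthge transform $\tilde M_z$ of $M_z$ is unitarily equivalent to the shift $M_z$ on $\mathcal{H}_{\tilde k}$, the reproducing kernel Hilbert space of $\tilde{\mathcal{W}}$-valued analytic functions on $\Omega$ with kernel $$\tilde k(z,w)=P_{\tilde{\mathcal{W}}}(I-zL)^{-1}(I-\bar wL^* )^{-1}|_{\tilde{\mathcal{W}}}\qquad(z,w\in\Omega),$$ where $P_{\tilde{\mathcal{W}}}$ is the orthogonal projection of $\mathcal{H}_k$ onto $\tilde{\mathcal{W}}$.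
   Context: $\mathbb{D}$ is the open unit disc. An analytic kernel $k:\mathbb{D}\times\mathbb{D}\to\mathcal{B}(\mathcal{E})$ is a positive definite kernel that is analytic in the first variable; $\mathcal{H}_k$ is its reproducing kernel Hilbert space of $\mathcal{E}$-valued analytic functions on $\mathbb{D}$ (with $\langle f,k(\cdot,w)\eta\rangle_{\mathcal{H}_k}=\langle f(w),\eta\rangle_{\mathcal{E}}$), and the shift $(M_zf)(w)=wf(w)$ is always assumed to be bounded on it. For a bounded operator $T$ on a Hilbert space: $|T|=(T^*T)^{1/2}$; $T=U|T|$ is the polar decomposition with $U$ the unique partial isometry with $\ker U=\ker T$; the Aluthge transform is $\tilde T=|T|^{1/2}U|T|^{1/2}$. $T$ is left-invertible if $XT=I$ for some bounded $X$ (equivalently $T^*T$ is invertible); then its Shimorin left inverse is $L_T=(T^*T)^{-1}T^*$. *)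

(* Defs.v *)
From HB Require Import structures.
From mathcomp Require Import all_boot all_order all_algebra.
From mathcomp Require Import sesquilinear complex.
From mathcomp Require Import all_classical all_reals.
From mathcomp Require Import topology normedtype sequences.

Set Implicit Arguments.
Unset Strict Implicit.
Unset Printing Implicit Defensive.

Import Order.TTheory GRing.Theory Num.Theory.
Import numFieldNormedType.Exports.
Local Open Scope classical_set_scope.
Local Open Scope ring_scope.
Local Open Scope complex_scope.

(* Complex Hilbert spaces. The inner product is linear in its first argument
   and conjugate-linear in the second, and it induces the norm. *)
HB.mixin Record CompleteNormedModule_isHilbert (R : realType) H
    of CompleteNormedModule R[i] H := {
  inner : {dot H for @Num.conj R[i]} ;
  innerxx : forall x : H, inner x x = `|x| ^+ 2
}.

#[short(type="hilbertType")]
HB.structure Definition Hilbert (R : realType) :=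
  {H of CompleteNormedModule_isHilbert R H & CompleteNormedModule R[i] H}.

Section Operators.
Context {R : realType}.
Implicit Types H K : hilbertType R.

Definition bounded_operator H K (T : H -> K) := linear T /\ continuous T.

Definition ker H K (T : H -> K) : set H := [set x | T x = 0].

Definition op_inverse H (T S : H -> H) :=
  [/\ bounded_operator S, cancel T S & cancel S T].

Definition op_invertible H (T : H -> H) := exists S, op_inverse T S.

Definition left_invertible H (T : H -> H) :=
  exists2 X : H -> H, bounded_operator X & cancel T X.

Definition positive_operator H (A : H -> H) :=
  bounded_operator A /\ forall x, 0 <= inner (A x) x.

Definition partial_isometry H (U : H -> H) :=
  bounded_operator U /\
  forall x, (forall y, ker U y -> inner x y = 0) -> `|U x| = `|x|.

(* The following operators are unique when they exist; the value 0 is only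
   used otherwise. *)

Definition inv_op H (T : H -> H) : H -> H :=
  xget (fun=> 0) [set S | op_inverse T S].

Definition adj_op H (T : H -> H) : H -> H :=
  xget (fun=> 0)
    [set S | bounded_operator S /\ forall x y, inner (T x) y = inner x (S y)].

Definition sqrt_op H (A : H -> H) : H -> H :=
  xget (fun=> 0) [set B | positive_operator B /\ B \o B = A].

Definition abs_op H (T : H -> H) : H -> H := sqrt_op (adj_op T \o T).

Definition polar_isometry H (T : H -> H) : H -> H :=
  xget (fun=> 0)
    [set U | [/\ partial_isometry U, T = U \o abs_op T & ker U = ker T]].

Definition aluthge H (T : H -> H) : H -> H :=
  sqrt_op (abs_op T) \o polar_isometry T \o sqrt_op (abs_op T).

Definition shimorin_left_inverse H (T : H -> H) : H -> H :=
  inv_op (adj_op T \o T) \o adj_op T.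

(* The orthogonal projection onto a closed subspace W. *)
Definition proj_op H (W : set H) (x : H) : H :=
  xget 0 [set y | W y /\ forall w, W w -> inner (x - y) w = 0].

Definition spectrum H (T : H -> H) : set R[i] :=
  [set l | ~ op_invertible (fun x => T x - l *: x)].

(* The norm of l : R[i] is the complex number with real part |l| and zero
   imaginary part. *)
Definition spectral_radius H (T : H -> H) : R :=
  sup [set complex.Re `|l| | l in spectrum T].

Definition unitary_operator H K (V : H -> K) :=
  [/\ bounded_operator V, forall x y, inner (V x) (V y) = inner x y
    & forall y, exists x, V x = y].

Definition unitarily_equivalent H K (T : H -> H) (S : K -> K) :=
  exists2 V : H -> K, unitary_operator V & V \o T = S \o V.

End Operators.

Section Kernels.
Context {R : realType}.
Implicit Types (E H : hilbertType R) (Omega : set R[i]).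

(* Analyticity on an open set, as local power series expansions: in the norm
   for vector-valued functions, in the operator norm for operator-valued
   functions. *)
Definition analytic_on E Omega (f : R[i] -> E) :=
  forall a, Omega a ->
  exists (c : nat -> E) (r : R[i]), 0 < r /\
    forall h, `|h| < r -> series (fun j => h ^+ j *: c j) @ \oo --> f (a + h).

Definition op_analytic_on E Omega (f : R[i] -> E -> E) :=
  forall a, Omega a ->
  exists (A : nat -> E -> E) (r : R[i]),
    [/\ forall j, bounded_operator (A j), 0 < r &
      forall h, `|h| < r -> forall e : R[i], 0 < e ->
      \forall n \near \oo, forall x,
        `|f (a + h) x - \sum_(j < n) h ^+ j *: A j x| <= e * `|x|].

Definition positive_definite_kernel E Omega (k : R[i] -> R[i] -> E -> E) :=
  forall (n : nat) (w : 'I_n -> R[i]) (eta : 'I_n -> E),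
    (forall j, Omega (w j)) ->
    0 <= \sum_(l < n) \sum_(j < n) inner (k (w l) (w j) (eta j)) (eta l).

Definition analytic_kernel E Omega (k : R[i] -> R[i] -> E -> E) :=
  [/\ forall z w, Omega z -> Omega w -> bounded_operator (k z w),
      positive_definite_kernel Omega k
    & forall w, Omega w -> op_analytic_on Omega (k^~ w)].

(* [is_rkhs Omega F k ev]: the Hilbert space H is the reproducing kernel
   Hilbert space on Omega of the B(F)-valued kernel k, where F is a closed
   subspace of E. An element f of H stands for the analytic function
   ev f : Omega -> F; functions on Omega and operators on F are represented by
   total functions whose values off Omega, resp. off F, are irrelevant. *)
Record is_rkhs E Omega (F : set E) (k : R[i] -> R[i] -> E -> E)
    H (ev : H -> R[i] -> E) : Prop := IsRKHS {
  rkhs_linear : forall z, Omega z -> linear (ev^~ z) ;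
  rkhs_inj : forall f, (forall z, Omega z -> ev f z = 0) -> f = 0 ;
  rkhs_val : forall f z, Omega z -> F (ev f z) ;
  rkhs_analytic : forall f, analytic_on Omega (ev f) ;
  rkhs_kernel : forall w eta, Omega w -> F eta ->
    exists2 kw : H, (forall z, Omega z -> ev kw z = k z w eta)
                  & (forall f, inner f kw = inner (ev f w) eta)
}.

(* S is the shift (multiplication by the variable), as a bounded operator. *)
Definition is_shift E Omega H (ev : H -> R[i] -> E) (S : H -> H) :=
  bounded_operator S /\
  forall f z, Omega z -> ev (S f) z = z *: ev f z.

Definition unit_disc : set R[i] := [set z | `|z| < 1].

(* |z| < 1/r, with 1/0 = +oo. *)
Definition disc_of_inv_radius (r : R) : set R[i] := [set z | r%:C * `|z| < 1].

(* P_W (I - z L)^-1 (I - conj(w) L^* )^-1 *)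
Definition resolvent_kernel H (L : H -> H) (W : set H) (z w : R[i]) : H -> H :=
  proj_op W \o inv_op (fun x => x - z *: L x)
            \o inv_op (fun x => x - Num.conj w *: adj_op L x).

End Kernels.

(* Main.v *)
Require Import Defs.
From HB Require Import structures.
From mathcomp Require Import all_boot all_order all_algebra.
From mathcomp Require Import sesquilinear complex ring lra.
From mathcomp Require Import all_classical all_reals.
From mathcomp Require Import topology normedtype sequences.

Set Implicit Arguments.
Unset Strict Implicit.
Unset Printing Implicit Defensive.

Import Order.TTheory GRing.Theory Num.Theory.
Import numFieldNormedType.Exports.
Local Open Scope classical_set_scope.
Local Open Scope ring_scope.
Local Open Scope complex_scope.

(** Write [T] for the shift, [A] for its modulus and [B] for the square root of
    [A]; left-invertibility makes [T^* T], hence [A] and [B], positive and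
    invertible. Then [T = (T A^-1) A] is the polar decomposition, so the Aluthge
    transform is [B (T A^-1) B = B T B^-1], an operator similar to [T]. The
    same algebra gives [(L_T A T)^-1 L_T = (T^* A T)^-1 T^*], so that [L] is
    [B (T^* A T)^-1 T^* B]: this is the Shimorin left inverse of
    [B T B^-1], and [1 - (B T B^-1) L] is the orthogonal projection onto
    the kernel [W] of the adjoint.

    The rest is Shimorin's analytic model of a left-invertible operator [S] with
    left inverse [L] and [P = 1 - S L] ([shimorin_rkhs], [shimorin_shift]): a
    vector [x] is sent to the function [P (1 - z L)^-1 x] on the disc where the
    resolvent exists. This turns [S] into multiplication by [z], because
    [L S = 1] and [P S = 0], and the reproducing property of the kernel is the
    definition of the adjoint. The map is injective when no nonzero vector lies
    in the range of every power of [S], for a vanishing function forces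
    [x = S L x = S^2 L^2 x = ...]. For the shift that condition holds since a
    function on the unit disc divisible by all powers of [z] vanishes to
    infinite order at 0, hence everywhere ([shift_analytic]), and it passes to
    operators similar to the shift. A reproducing kernel Hilbert space is
    determined by its kernel up to a unitary operator that preserves the
    functions ([rkhs_unitary]), which moves the result from this model to any
    other realization of the space.

    The operators that enter the statement are shown to exist on the way:
    inverses come from the Neumann series ([neumann_invertible]), adjoints from
    the Riesz representation theorem ([riesz]), and square roots, needed only
    for invertible positive operators, from a contracting iteration
    ([coercive_sqrt]). *)

(** * Real-valued norms and geometric convergence *)

Section RealNorm.
Context {R : realType}.

(** Norms take values in the complex numbers, which are only partially ordered;
    their real parts are compared instead, so that real arithmetic applies. *)
Definition nrm (V : normedZmodType R[i]) (x : V) : R := complex.Re `|x|.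

Section Normed.
Context {V : normedZmodType R[i]}.
Implicit Types x y : V.

Lemma nrmE x : `|x| = (nrm x)%:C.
Proof. by rewrite /nrm RRe_real// normr_real. Qed.

Lemma nrm_ge0 x : 0 <= nrm x.
Proof. by rewrite -lecR -nrmE normr_ge0. Qed.

Lemma nrm0 : nrm (0 : V) = 0.
Proof. by rewrite /nrm normr0. Qed.

Lemma nrm0_eq0 x : nrm x = 0 -> x = 0.
Proof. by move=> x0; apply: normr0_eq0; rewrite nrmE x0. Qed.

Lemma nrm_le0_eq0 x : nrm x <= 0 -> x = 0.
Proof. by move=> x0; apply: nrm0_eq0; apply/eqP; rewrite eq_le x0 nrm_ge0. Qed.

Lemma nrm_gt0 x : x != 0 -> 0 < nrm x.
Proof. by move=> x0; rewrite -ltcR -nrmE normr_gt0. Qed.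

Lemma nrmN x : nrm (- x) = nrm x.
Proof. by rewrite /nrm normrN. Qed.

Lemma nrmC x y : nrm (x - y) = nrm (y - x).
Proof. by rewrite -nrmN opprB. Qed.

Lemma nrmD x y : nrm (x + y) <= nrm x + nrm y.
Proof. by rewrite -lecR rmorphD /= -!nrmE ler_normD. Qed.

Lemma nrmB x y : nrm (x - y) <= nrm x + nrm y.
Proof. by rewrite -(nrmN y) nrmD. Qed.

Lemma nrm_dist x y z : nrm (x - z) <= nrm (x - y) + nrm (y - z).
Proof. by rewrite -[x - z](subrKA y) nrmD. Qed.

Lemma nrm_split x y : nrm x <= nrm (x - y) + nrm y.
Proof. by rewrite -[x in leLHS](subrK y) nrmD. Qed.

End Normed.

Lemma nrmc1 : nrm (1 : R[i]) = 1.
Proof. by rewrite /nrm normr1. Qed.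

Lemma nrmcM (a b : R[i]) : nrm (a * b) = nrm a * nrm b.
Proof. by apply: complexI; rewrite rmorphM /= -!nrmE normrM. Qed.

Lemma nrmcX (a : R[i]) n : nrm (a ^+ n) = nrm a ^+ n.
Proof. by elim: n => [|n IHn]; rewrite ?expr0 ?nrmc1// !exprS nrmcM IHn. Qed.

Lemma nrmcV (a : R[i]) : nrm (a^-1) = (nrm a)^-1.
Proof. by apply: complexI; rewrite fmorphV /= -!nrmE normfV. Qed.

Lemma nrmR (a : R) : nrm a%:C = `|a|.
Proof. by rewrite /nrm normc_def/= expr0n /= addr0 sqrtr_sqr. Qed.

Lemma nrm_conj (a : R[i]) : nrm (Num.conj a) = nrm a.
Proof. by rewrite /nrm norm_conjC. Qed.

Lemma nrmZ (V : normedModType R[i]) (a : R[i]) (x : V) :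
  nrm (a *: x) = nrm a * nrm x.
Proof. by apply: complexI; rewrite rmorphM /= -!nrmE normrZ. Qed.

End RealNorm.

Section RealConvergence.
Context {R : realType} {V : normedModType R[i]}.
Implicit Types (u : nat -> V) (l : V).

Lemma nrm_cvgP u l : u @ \oo --> l <->
  forall e : R, 0 < e -> exists N, forall n, (N <= n)%N -> nrm (l - u n) <= e.
Proof.
split=> [ul e e0|H].
  have /cvgrPdist_le/(_ e%:C) := ul; rewrite ltcR => /(_ e0)[N _ NP].
  by exists N => n Nn; rewrite -lecR -nrmE; exact: NP.
apply/cvgrPdist_le => e e0.
have eE : e = (complex.Re e)%:C by rewrite RRe_real// gtr0_real.
move: e0; rewrite eE ltcR => /H[N NP].
by exists N => // n Nn; rewrite /= nrmE lecR; exact: NP.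
Qed.

Lemma nrm_cvg_unique u l l' : u @ \oo --> l -> u @ \oo --> l' -> l = l'.
Proof. exact: cvg_unique. Qed.

Lemma le_nrm_lim u l m (C : R) : u @ \oo --> l ->
  (exists N, forall n, (N <= n)%N -> nrm (m - u n) <= C) -> nrm (m - l) <= C.
Proof.
move=> /nrm_cvgP ul [N NP]; apply/ler_addgt0Pr => e e0.
have [M MP] := ul _ e0; set n := maxn N M.
apply: (le_trans (nrm_dist _ (u n) _)); rewrite lerD//.
  by apply: NP; rewrite leq_maxl.
by rewrite nrmC; apply: MP; rewrite leq_maxr.
Qed.

End RealConvergence.

Section GeometricConvergence.
Context {R : realType}.

Lemma geom_eventually (q C e : R) : 0 <= q -> q < 1 -> 0 < e ->
  exists N, forall n, (N <= n)%N -> C * q ^+ n <= e.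
Proof.
move=> q0 q1 e0.
have /cvgrPdist_le/(_ e e0)[N _ NP] : (fun n => C * q ^+ n) @ \oo --> (0 : R).
  by rewrite -(mulr0 C); apply: cvgMr; apply: cvg_expr; rewrite ger0_norm.
exists N => n Nn; have := NP n Nn; rewrite /= sub0r normrN.
exact: le_trans (ler_norm _).
Qed.

(** Completeness enters through this criterion. For operators applied to a
    vector, a constant [C] proportional to the norm of the vector makes the
    convergence uniform on bounded sets. *)
Lemma geom_cvg (V : completeNormedModType R[i]) (u : nat -> V) (C q : R) :
    0 <= q -> q < 1 -> (forall n, nrm (u n.+1 - u n) <= C * q ^+ n) ->
  exists2 l, u @ \oo --> l & forall n, nrm (l - u n) <= C / (1 - q) * q ^+ n.
Proof.
move=> q0 q1 uC.
have q1' : 0 < 1 - q by rewrite subr_gt0.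
have C0 : 0 <= C by have := le_trans (nrm_ge0 _) (uC 0%N); rewrite expr0 mulr1.
pose K := C / (1 - q).
have KE : K * (1 - q) = C by rewrite /K divfK// gt_eqF.
have K0 : 0 <= K by rewrite divr_ge0// ltW.
have un n m : nrm (u (n + m)%N - u n) <= K * q ^+ n.
  suff : nrm (u (n + m)%N - u n) <= K * q ^+ n * (1 - q ^+ m).
    move/le_trans; apply; apply: ler_piMr; first by rewrite mulr_ge0 ?exprn_ge0.
    by rewrite gerBl exprn_ge0.
  elim: m => [|m IHm]; first by rewrite addn0 subrr nrm0 expr0 subrr mulr0.
  rewrite addnS; apply: (le_trans (nrm_dist _ (u (n + m)%N) _)).
  apply: (le_trans (lerD (uC _) IHm)); rewrite -KE exprD exprS.
  by rewrite le_eqVlt; apply/orP; left; apply/eqP; ring.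
have cu : cvg (u @ \oo).
  apply/cauchy_cvgP/cauchy_ballP => e e0.
  have eE : e = (complex.Re e)%:C by rewrite RRe_real// gtr0_real.
  move: e0; rewrite eE ltcR; set r := complex.Re e => r0.
  have [N NP] := geom_eventually (2 * K) q0 q1 (divr_gt0 r0 (@ltr0n R 2)).
  exists (u @` [set n | (N <= n)%N], u @` [set n | (N <= n)%N]); first split.
  - by exists N => // n Nn; exists n.
  - by exists N => // n Nn; exists n.
  move=> [x y] /= [[n Nn <-] [m Nm <-]].
  rewrite -ball_normE /= nrmE ltcR.
  apply: (le_lt_trans (nrm_dist _ (u N) _)); rewrite [nrm (u N - _)]nrmC.
  have := un N (n - N)%N; have := un N (m - N)%N; have := NP N (leqnn N).
  by rewrite !subnKC//; lra.
exists (lim (u @ \oo)) => // n; rewrite nrmC; apply: (le_nrm_lim cu).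
exists n => m nm; rewrite nrmC; have := un n (m - n)%N.
by rewrite subnKC.
Qed.

End GeometricConvergence.

(** * Inner products *)

Lemma conjR (R : realType) (a : R) : Num.conj (a%:C : R[i]) = a%:C.
Proof. by rewrite conj_Creal// complex_real. Qed.

Section Inner.
Context {R : realType} {H : hilbertType R}.
Implicit Types x y z : H.

Definition rdot x y : R := complex.Re (inner x y).

Lemma innerC x y : inner x y = Num.conj (inner y x).
Proof. by have := hermC (@inner R H) x y; rewrite expr0 mul1r. Qed.

Lemma innerDl x y z : inner (x + y) z = inner x z + inner y z.
Proof. exact: linearDl. Qed.

Lemma innerDr x y z : inner x (y + z) = inner x y + inner x z.
Proof. exact: linearDr. Qed.

Lemma innerBl x y z : inner (x - y) z = inner x z - inner y z.
Proof. exact: linearBl. Qed.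

Lemma innerBr x y z : inner x (y - z) = inner x y - inner x z.
Proof. exact: linearBr. Qed.

Lemma innerZl a x y : inner (a *: x) y = a * inner x y.
Proof. exact: linearZl_LR. Qed.

Lemma innerZr a x y : inner x (a *: y) = Num.conj a * inner x y.
Proof. exact: linearZr_LR. Qed.

Lemma inner0l x : inner 0 x = 0.
Proof. exact: linear0l. Qed.

Lemma inner0r x : inner x 0 = 0.
Proof. exact: linear0r. Qed.

Lemma inner_nrm x : inner x x = (nrm x ^+ 2)%:C.
Proof. by rewrite innerxx nrmE rmorphXn. Qed.

Lemma rdotDl x y z : rdot (x + y) z = rdot x z + rdot y z.
Proof. by rewrite /rdot innerDl raddfD. Qed.

Lemma rdotC x y : rdot x y = rdot y x.
Proof. by rewrite /rdot innerC; case: (inner y x). Qed.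

Lemma rdotDr x y z : rdot x (y + z) = rdot x y + rdot x z.
Proof. by rewrite !(rdotC x) rdotDl. Qed.

Lemma rdotNl x y : rdot (- x) y = - rdot x y.
Proof. by rewrite /rdot linearNl raddfN. Qed.

Lemma rdotNr x y : rdot x (- y) = - rdot x y.
Proof. by rewrite !(rdotC x) rdotNl. Qed.

Lemma rdotZl (a : R) x y : rdot (a%:C *: x) y = a * rdot x y.
Proof.
by rewrite /rdot innerZl; case: (inner x y) => b c /=; rewrite mul0r subr0.
Qed.

Lemma rdotZr (a : R) x y : rdot x (a%:C *: y) = a * rdot x y.
Proof. by rewrite !(rdotC x) rdotZl. Qed.

Lemma rdotxx x : rdot x x = nrm x ^+ 2.
Proof. by rewrite /rdot inner_nrm. Qed.

(** The imaginary part of the inner product is a real part as well: this turns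
    identities between real parts, valid for a whole complex subspace, into
    identities between inner products. *)
Lemma inner_rdot x y :
  inner x y = (rdot x y)%:C + 'i * (rdot ((- 'i) *: x) y)%:C.
Proof.
rewrite /rdot innerZl; case: (inner x y) => a b /=; simpc.
by [].
Qed.

Lemma rdotZi x y : rdot ((- 'i) *: x) y = rdot x ('i *: y).
Proof.
rewrite /rdot innerZl innerZr; congr (complex.Re (_ * _)).
by apply/eqP; rewrite eq_complex /= oppr0 !eqxx.
Qed.

Lemma nrmDsqr x y : nrm (x + y) ^+ 2 = nrm x ^+ 2 + 2 * rdot x y + nrm y ^+ 2.
Proof. by rewrite -!rdotxx rdotDl !rdotDr (rdotC y x); ring. Qed.

Lemma nrmBsqr x y : nrm (x - y) ^+ 2 = nrm x ^+ 2 - 2 * rdot x y + nrm y ^+ 2.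
Proof. by rewrite nrmDsqr nrmN rdotNr; ring. Qed.

Lemma inner_eq0 x : (forall y, inner x y = 0) -> x = 0.
Proof.
move=> /(_ x); rewrite inner_nrm => /(@complexI R _ 0)/eqP.
by rewrite sqrf_eq0 => /eqP/nrm0_eq0.
Qed.

Lemma inner_inj x x' : (forall y, inner x y = inner x' y) -> x = x'.
Proof.
move=> xx'; apply/eqP; rewrite -subr_eq0; apply/eqP/inner_eq0 => y.
by rewrite innerBl xx' subrr.
Qed.

End Inner.

(** Applied to the inner product, and to the possibly degenerate form of a
    positive operator. *)
Lemma discriminant_le (R : realFieldType) (a b c : R) :
  0 <= c -> (forall t, 0 <= a + 2 * (t * b) + t ^+ 2 * c) -> b ^+ 2 <= a * c.
Proof.
move=> c0 abc.
have [c00|cN0] := eqVneq c 0.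
  rewrite c00 mulr0.
  have h t : 0 <= a + 2 * (t * b) by have := abc t; rewrite c00 mulr0 addr0.
  have [->|b0] := eqVneq b 0; first by rewrite expr0n.
  have := h (- (a + 1) / (2 * b)).
  have -> : a + 2 * (- (a + 1) / (2 * b) * b) = -1 by field.
  by rewrite oppr_ge0 ler10.
have cp : 0 < c by rewrite lt_neqAle eq_sym cN0.
have := abc (- b / c).
have -> : a + 2 * (- b / c * b) + (- b / c) ^+ 2 * c = (a * c - b ^+ 2) / c.
  by field.
by rewrite pmulr_lge0 ?invr_gt0// subr_ge0.
Qed.

Section CauchySchwarz.
Context {R : realType} {H : hilbertType R}.
Implicit Types x y z : H.

Lemma rdot_le x y : `|rdot x y| <= nrm x * nrm y.
Proof.
rewrite -(@ler_pXn2r _ 2)// ?nnegrE ?mulr_ge0 ?nrm_ge0//.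
rewrite real_normK ?num_real// exprMn; apply: discriminant_le => [|t].
  by rewrite exprn_ge0 ?nrm_ge0.
rewrite -rdotZr; have <- : nrm (t%:C *: y) ^+ 2 = t ^+ 2 * nrm y ^+ 2.
  by rewrite nrmZ nrmR exprMn real_normK ?num_real.
by rewrite -nrmDsqr sqr_ge0.
Qed.

(** Multiplying [x] by the conjugate of [inner x y] makes the inner product a
    nonnegative real number, which reduces the claim to its real part. *)
Lemma inner_le x y : nrm (inner x y) <= nrm x * nrm y.
Proof.
set a := inner x y.
have [a0|a0] := eqVneq a 0; first by rewrite a0 nrm0 mulr_ge0 ?nrm_ge0.
have na := nrm_gt0 a0.
rewrite -(ler_pM2l na) -expr2.
have -> : nrm a ^+ 2 = rdot (Num.conj a *: x) y.
  rewrite /rdot innerZl -/a; apply: complexI; rewrite mulrC -normCK nrmE.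
  by rewrite -rmorphXn.
apply: (le_trans (ler_norm _)); apply: (le_trans (rdot_le _ _)).
by rewrite nrmZ nrm_conj mulrA.
Qed.

Lemma inner_cvg (u : nat -> H) l y :
  u @ \oo --> l -> (fun n => inner (u n) y) @ \oo --> inner l y.
Proof.
move=> /nrm_cvgP ul; apply/(@nrm_cvgP _ R[i]^o) => e e0.
have y1 : 0 < nrm y + 1 by rewrite ltr_wpDl ?nrm_ge0.
have [N NP] := ul _ (divr_gt0 e0 y1); exists N => n /NP.
rewrite ler_pdivlMr// => le_e; rewrite -innerBl.
apply: (le_trans (inner_le _ _)); apply: le_trans le_e.
by rewrite ler_wpM2l ?nrm_ge0// lerDl.
Qed.

End CauchySchwarz.

(** * Bounded operators and the Neumann series *)

Section LinearMaps.
Context {R : realType} {V W : lmodType R[i]} {T : V -> W}.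
Hypothesis lT : linear T.

Lemma linD x y : T (x + y) = T x + T y.
Proof. by rewrite -[x in LHS]scale1r lT scale1r. Qed.

Lemma lin0 : T 0 = 0.
Proof. by apply: (addIr (T 0)); rewrite -linD !add0r. Qed.

Lemma linZ a x : T (a *: x) = a *: T x.
Proof. by rewrite -[a *: x]addr0 lT lin0 !addr0. Qed.

Lemma linN x : T (- x) = - T x.
Proof. by rewrite -scaleN1r linZ scaleN1r. Qed.

Lemma linB x y : T (x - y) = T x - T y.
Proof. by rewrite linD linN. Qed.

Lemma lin_sum n (F : nat -> V) :
  T (\sum_(j < n) F j) = \sum_(j < n) T (F j).
Proof.
elim: n => [|n IHn]; first by rewrite !big_ord0 lin0.
by rewrite !big_ord_recr /= linD IHn.
Qed.

Lemma lin_inj : (forall x, T x = 0 -> x = 0) -> injective T.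
Proof.
move=> T0 x y Txy; apply/eqP; rewrite -subr_eq0; apply/eqP/T0.
by rewrite linB Txy subrr.
Qed.

End LinearMaps.

Lemma linear_comp (R : realType) (V W Z : lmodType R[i])
    (T : W -> Z) (S : V -> W) :
  linear T -> linear S -> linear (T \o S).
Proof. by move=> lT lS a x y /=; rewrite lS lT. Qed.

Lemma linear_iter (R : realType) (V : lmodType R[i]) (T : V -> V) n :
  linear T -> linear (iter n T).
Proof. by move=> lT; elim: n => [//|n IHn] a x y /=; rewrite IHn lT. Qed.

Lemma linear_id_sub (R : realType) (V : lmodType R[i]) (a : R[i]) (T : V -> V) :
  linear T -> linear (fun x => x - a *: T x).
Proof.
move=> lT b x y; rewrite lT scalerDr scalerBr opprD addrACA; congr (_ - _ + _).
by rewrite !scalerA mulrC.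
Qed.

Section BoundedOperators.
Context {R : realType}.
Implicit Types H K L : hilbertType R.

Lemma bounded_operatorP H K (T : H -> K) : bounded_operator T <->
  linear T /\ exists2 M : R, 0 < M & forall x, nrm (T x) <= M * nrm x.
Proof.
split=> [[lT cT]|[lT [M M0 TM]]]; split=> //.
- pose T' : {linear H -> K} := HB.pack T (GRing.isLinear.Build _ _ _ _ T lT).
  have /linear_boundedP[r [r_real]] :=
    @continuous_linear_bounded _ _ _ 0 T' (cT 0).
  move=> /(_ (`|r| + 1)) TM; have rE : `|r| + 1 = (nrm r + 1)%:C.
    by rewrite rmorphD /= -nrmE.
  exists (nrm r + 1); first by rewrite ltr_wpDl ?nrm_ge0.
  move=> x; rewrite -lecR rmorphM /= -rE -(nrmE x) -(nrmE (T x)).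
  have r1 : r < `|r| + 1 by rewrite (le_lt_trans (real_ler_norm r_real))// ltrDl.
  exact: (TM r1 x).
- pose T' : {linear H -> K} := HB.pack T (GRing.isLinear.Build _ _ _ _ T lT).
  apply: (@bounded_linear_continuous _ _ _ T'); apply/linear_boundedP.
  exists M%:C; split; first by rewrite complex_real.
  move=> r Mr x; apply: (@le_trans _ _ (M%:C * `|x|)).
    by rewrite !nrmE -rmorphM lecR; exact: TM.
  by rewrite ler_wpM2r// ltW.
Qed.

Lemma bounded_comp H K L (T : K -> L) (S : H -> K) :
  bounded_operator T -> bounded_operator S -> bounded_operator (T \o S).
Proof.
move=> [lT cT] [lS cS]; split; first exact: linear_comp.
by move=> x; apply: continuous_comp; [exact: cS|exact: cT].
Qed.

Lemma bounded_id H : bounded_operator (@id H).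
Proof. by split=> // x; exact: cvg_id. Qed.

Lemma bounded_id_sub H (a : R[i]) (T : H -> H) :
  bounded_operator T -> bounded_operator (fun x => x - a *: T x).
Proof.
move=> /bounded_operatorP[lT [M M0 TM]]; apply/bounded_operatorP.
split; first exact: linear_id_sub.
exists (1 + nrm a * M); first by rewrite ltr_wpDr// mulr_ge0 ?nrm_ge0 ?ltW.
move=> x; apply: (le_trans (nrmB _ _)); rewrite mulrDl mul1r lerD2l nrmZ.
by rewrite -mulrA ler_wpM2l ?nrm_ge0.
Qed.

Lemma bounded_scale H (a : R[i]) (T : H -> H) :
  bounded_operator T -> bounded_operator (fun x => a *: T x).
Proof.
move=> /bounded_operatorP[lT [M M0 TM]]; apply/bounded_operatorP; split.
  by move=> b x y; rewrite lT scalerDr !scalerA mulrC.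
exists (nrm a * M + 1); first by rewrite ltr_wpDl// mulr_ge0 ?nrm_ge0 ?ltW.
move=> x; rewrite nrmZ mulrDl mul1r -mulrA.
by apply: ler_wpDr; rewrite ?nrm_ge0// ler_wpM2l ?nrm_ge0.
Qed.

Lemma bounded_cvg H K (T : H -> K) (u : nat -> H) l :
  bounded_operator T -> u @ \oo --> l -> (T \o u) @ \oo --> T l.
Proof. by move=> [_ cT] ul; apply: cvg_comp ul (cT l). Qed.

Lemma op_inverse_uniq H (T S S' : H -> H) :
  op_inverse T S -> op_inverse T S' -> S = S'.
Proof.
by move=> [_ TS _] [_ _ S'T]; apply/funext => x; rewrite -[RHS]TS S'T.
Qed.

Lemma inv_op_eq H (T S : H -> H) : op_inverse T S -> inv_op T = S.
Proof.
by move=> TS; apply: xget_unique => // S' TS'; exact: op_inverse_uniq TS' TS.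
Qed.

Lemma inv_opP H (T : H -> H) : op_invertible T -> op_inverse T (inv_op T).
Proof. by move=> [S TS]; rewrite (inv_op_eq TS). Qed.

Lemma op_inverse_comp H (T T' S S' : H -> H) :
  op_inverse T S -> op_inverse T' S' -> op_inverse (T \o T') (S' \o S).
Proof.
move=> [bS TS ST] [bS' TS' ST']; split; first exact: bounded_comp.
- by move=> x /=; rewrite TS TS'.
- by move=> x /=; rewrite ST' ST.
Qed.

(** The lower bound gives injectivity, and bounds the inverse function. *)
Lemma op_invertible_surj H (T : H -> H) (c : R) : linear T -> 0 < c ->
  (forall x, c * nrm x <= nrm (T x)) -> (forall y, exists x, T x = y) ->
  op_invertible T.
Proof.
move=> lT c0 Tc /choice[S TS].
have Tinj : injective T.
  apply: (lin_inj lT) => x Tx0; apply: nrm_le0_eq0.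
  by have := Tc x; rewrite Tx0 nrm0 pmulr_rle0.
exists S; split=> //; last by move=> x; apply: Tinj.
apply/bounded_operatorP; split.
  by move=> a x y; apply: Tinj; rewrite lT !TS.
exists c^-1; first by rewrite invr_gt0.
move=> x; rewrite mulrC ler_pdivlMr// mulrC; apply: (le_trans (Tc _)).
by rewrite TS.
Qed.

(** The sum of the Neumann series is a preimage of [y]; the lower bound [1 - q]
    takes care of injectivity and of the norm of the inverse. *)
Lemma neumann_invertible H (X : H -> H) (q : R) : linear X -> 0 <= q -> q < 1 ->
  (forall x, nrm (X x) <= q * nrm x) -> op_invertible (fun x => x - X x).
Proof.
move=> lX q0 q1 Xq.
have q1' : 0 < 1 - q by rewrite subr_gt0.
have bX : bounded_operator X.
  apply/bounded_operatorP; split=> //; exists (q + 1); first exact: ltr_wpDl.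
  move=> x; apply: (le_trans (Xq x)); rewrite ler_wpM2r ?nrm_ge0//.
  by rewrite lerDl.
have iterq n x : nrm (iter n X x) <= nrm x * q ^+ n.
  elim: n => [|n IHn]; first by rewrite mulr1.
  rewrite iterS; apply: (le_trans (Xq _)).
  by rewrite exprS mulrCA ler_wpM2l.
apply: (@op_invertible_surj _ _ (1 - q)) => //.
- by move=> a x y; rewrite lX scalerBr opprD addrACA.
- move=> x; rewrite mulrBl mul1r lerBlDr; apply: (le_trans (nrm_split _ (X x))).
  by rewrite lerD2l.
- move=> y; pose u n := \sum_(j < n) iter j X y.
  have uS n : u n.+1 - u n = iter n X y.
    by rewrite /u big_ord_recr /= [LHS]addrC addKr.
  have uX n : u n.+1 = y + X (u n).
    by rewrite /u big_ord_recl /= (lin_sum lX n (fun j => iter j X y)).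
  have [s us _] : exists2 l, u @ \oo --> l &
      forall n, nrm (l - u n) <= nrm y / (1 - q) * q ^+ n.
    by apply: geom_cvg => // n; rewrite uS.
  exists s; apply/eqP; rewrite subr_eq; apply/eqP.
  apply: (nrm_cvg_unique us); apply/nrm_cvgP => e e0.
  have /nrm_cvgP/(_ e e0)[N NP] := bounded_cvg bX us.
  exists N.+1 => -[//|n] Nn; rewrite uX opprD addrACA subrr add0r.
  exact: NP.
Qed.

(** Telescoping: the Neumann series at [s - X s] converges to [s] as soon as the
    iterates of [X] at [s] tend to 0. *)
Lemma neumann_partial_sum (V : lmodType R[i]) (X : V -> V) s n : linear X ->
  \sum_(j < n) iter j X (s - X s) = s - iter n X s.
Proof.
move=> lX; elim: n => [|n IHn]; first by rewrite big_ord0 subrr.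
by rewrite big_ord_recr /= IHn (linB (linear_iter n lX)) -iterSr addrA subrK.
Qed.

End BoundedOperators.

(** * Positive operators *)

Section PositiveOperators.
Context {R : realType} {H : hilbertType R}.
Implicit Types (A T X : H -> H) (x y z : H).

Definition adjoint T S := forall x y, inner (T x) y = inner x (S y).

Lemma adjoint_sym T S : adjoint T S -> adjoint S T.
Proof. by move=> TS x y; rewrite innerC -TS -innerC. Qed.

Lemma adjoint_uniq T S S' : adjoint T S -> adjoint T S' -> S = S'.
Proof.
move=> /adjoint_sym ST /adjoint_sym S'T; apply/funext => x.
by apply: inner_inj => y; rewrite ST S'T.
Qed.

Lemma adjoint_comp T T' S S' :
  adjoint T S -> adjoint T' S' -> adjoint (T \o T') (S' \o S).
Proof. by move=> TS TS' x y; rewrite /= TS TS'. Qed.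

Lemma adjoint_inverse A B : adjoint A A -> op_inverse A B -> adjoint B B.
Proof.
by move=> AA [_ AB BA] x y; rewrite -[x in RHS]BA AA BA.
Qed.

(** Polarization: over the complex numbers a quadratic form that takes only
    real values comes from a self-adjoint operator. *)
Lemma positive_adjoint A : positive_operator A -> adjoint A A.
Proof.
move=> [[lA _] A0] x y; rewrite [RHS]innerC.
have Im0 z : complex.Im (inner (A z) z) = 0 by apply/ger0_Im/A0.
have := Im0 ('i *: y + x); have := Im0 (y + x).
rewrite !(linD lA) !(linZ lA) !innerDl !innerDr !innerZl !innerZr.
rewrite !raddfD /= !Im0 -/(complex.Re _).
case: (inner (A x) y) => a b; case: (inner (A y) x) => c d; move: (Im0 y).
case: (inner (A y) y) => e f /= -> h1 h2.
by apply/eqP; rewrite eq_complex /=; apply/andP; split; apply/eqP; lra.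
Qed.

(** The Cauchy-Schwarz inequality for the form of [A], at the vectors [x] and
    [A x], turns a bound on the quadratic form into one on the norm. *)
Lemma positive_bound A c : positive_operator A -> 0 <= c ->
  (forall x, rdot (A x) x <= c * nrm x ^+ 2) -> forall x, nrm (A x) <= c * nrm x.
Proof.
move=> pA c0 Ac x; have sA := positive_adjoint pA; have [[lA _] A0] := pA.
have A0' z : 0 <= rdot (A z) z by have := A0 z; rewrite lecE => /andP[].
have [Ax0|Ax0] := eqVneq (A x) 0; first by rewrite Ax0 nrm0 mulr_ge0 ?nrm_ge0.
have CS : rdot (A x) (A x) ^+ 2 <= rdot (A x) x * rdot (A (A x)) (A x).
  apply: discriminant_le => // t.
  have := A0' (x + t%:C *: A x).
  rewrite (linD lA) (linZ lA) !rdotDl !rdotDr !rdotZl !rdotZr.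
  by rewrite [rdot (A (A x)) x]/rdot sA -/(rdot _ _) => h; lra.
have Ax1 := nrm_gt0 Ax0.
have : nrm (A x) ^+ 2 * nrm (A x) ^+ 2 <= (c * nrm x) ^+ 2 * nrm (A x) ^+ 2.
  have -> : (c * nrm x) ^+ 2 * nrm (A x) ^+ 2 =
            (c * nrm x ^+ 2) * (c * nrm (A x) ^+ 2) by ring.
  move: CS; rewrite rdotxx expr2 => /le_trans; apply.
  by apply: ler_pM.
rewrite ler_pM2r ?exprn_gt0// ler_pXn2r// nnegrE ?mulr_ge0 ?nrm_ge0//.
Qed.

(** These are the invertible positive operators; the lower bound is what makes
    them, up to a factor, contractive perturbations of the identity. *)
Definition coercive A :=
  positive_operator A /\
  exists2 c : R, 0 < c & forall x, c * nrm x ^+ 2 <= rdot (A x) x.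

Lemma coercive_id : coercive id.
Proof.
split; first split=> [|x]; first exact: bounded_id.
  by rewrite inner_nrm ler0c sqr_ge0.
by exists 1 => // x; rewrite rdotxx mul1r.
Qed.

(** The form of [S A T] at [x] is the form of [A] at [T x]. *)
Lemma coercive_conj A T S (c : R) : coercive A ->
  bounded_operator T -> bounded_operator S -> adjoint T S ->
  0 < c -> (forall x, c * nrm x <= nrm (T x)) -> coercive (S \o A \o T).
Proof.
move=> [[bA A0] [a a0 Aa]] bT bS /adjoint_sym ST c0 Tc; split; first split.
- by apply: bounded_comp => //; exact: bounded_comp.
- by move=> x; rewrite /= ST.
- exists (a * c ^+ 2); first by rewrite mulr_gt0 ?exprn_gt0.
  move=> x; rewrite /rdot /= ST; apply: le_trans (Aa _).
  rewrite -mulrA -exprMn ler_pM2l// ler_pXn2r// nnegrE ?nrm_ge0//.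
  by rewrite mulr_ge0 ?nrm_ge0// ltW.
Qed.

(** With [M] an upper bound and [c] a lower bound of the form of [A], the form
    of [1 - A / M] lies between 0 and [1 - c / M]. *)
Lemma coercive_scaled A : coercive A -> exists M q : R,
  [/\ 0 < M, 0 <= q, q < 1 &
    forall x, nrm (x - M^-1%:C *: A x) <= q * nrm x].
Proof.
move=> [pA [c c0 Ac]]; have [bA A0] := pA.
have /bounded_operatorP[lA [M' M'0 AM']] := bA.
pose M := M' + c; have M0 : 0 < M by rewrite addr_gt0.
have Mi0 : 0 < M^-1 by rewrite invr_gt0.
have AM x : rdot (A x) x <= M * nrm x ^+ 2.
  apply: (le_trans (ler_norm _)); apply: (le_trans (rdot_le _ _)).
  rewrite expr2 mulrA ler_wpM2r ?nrm_ge0//; apply: (le_trans (AM' _)).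
  by rewrite ler_wpM2r ?nrm_ge0// lerDl ltW.
have cM : c / M < 1 by rewrite ltr_pdivrMr// mul1r ltrDr.
exists M, (1 - c / M); split=> //.
- by rewrite subr_ge0 ltW.
- by rewrite ltrBlDr ltrDl divr_gt0.
have rX x : rdot (x - M^-1%:C *: A x) x = nrm x ^+ 2 - M^-1 * rdot (A x) x.
  by rewrite rdotDl rdotNl rdotZl rdotxx.
apply: (@positive_bound (fun x => x - M^-1%:C *: A x)).
- split; first exact: bounded_id_sub.
  move=> x; rewrite lecE; apply/andP; split.
    rewrite innerBl innerZl inner_nrm raddfB /=.
    have := ger0_Im (A0 x); case: (inner (A x) x) => u v /= ->.
    by rewrite mulr0 mul0r addr0 subr0.
  change (0 <= rdot (x - M^-1%:C *: A x) x).
  by rewrite rX subr_ge0 mulrC ler_pdivrMr// mulrC.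
- by rewrite subr_ge0 ltW.
- move=> x; rewrite rX mulrBl mul1r lerB// mulrAC mulrC.
  by rewrite ler_pM2l.
Qed.

Lemma coercive_invertible A : coercive A -> op_invertible A.
Proof.
move=> cA; have [M [q [M0 q0 q1 Xq]]] := coercive_scaled cA.
have [[[lA _] _] _] := cA.
have M1 : (M^-1%:C : R[i]) * M%:C = 1 by rewrite -rmorphM /= mulVf// gt_eqF.
pose X x := x - M^-1%:C *: A x.
have lX : linear X by exact: linear_id_sub.
have [S [bS XS SX]] := neumann_invertible lX q0 q1 Xq.
have XE x : x - X x = M^-1%:C *: A x by rewrite /X opprB addrC subrK.
exists (fun x => M^-1%:C *: S x); split.
- exact: bounded_scale.
- move=> x; have [lS _] := bS.
  by rewrite -(linZ lS) -XE XS.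
- move=> x; rewrite (linZ lA) -XE SX.
  by [].
Qed.

End PositiveOperators.

(** * Square roots *)

Section SquareRoot.
Context {R : realType} {H : hilbertType R}.
Implicit Types (A B C X Y : H -> H) (x y z : H).

(** [1 - Y] is a square root of [1 - X] when [2 Y = X + Y^2]. Starting from 0,
    the iteration of this equation stays in the ball of radius [q] and contracts
    there by the factor [q]; its terms are polynomials in [X], hence the
    commutation property of the limit. *)
Lemma sqrt_near_id X (q : R) : linear X -> adjoint X X -> 0 <= q -> q < 1 ->
  (forall x, nrm (X x) <= q * nrm x) ->
  exists Y, [/\ linear Y, adjoint Y Y, forall x, nrm (Y x) <= q * nrm x,
    forall x, Y x = 2^-1 *: (X x + Y (Y x)) &
    forall C, bounded_operator C -> C \o X = X \o C -> C \o Y = Y \o C].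
Proof.
move=> lX sX q0 q1 Xq.
pose F Y x := 2^-1 *: (X x + Y (Y x)).
pose Yn n := iter n F (fun=> 0).
have YnS n x : Yn n.+1 x = 2^-1 *: (X x + Yn n (Yn n x)) by [].
have half2 : nrm (2^-1 : R[i]) = 2^-1.
  have -> : (2^-1 : R[i]) = (2^-1)%:C by rewrite fmorphV rmorph_nat.
  by rewrite nrmR ger0_norm// invr_ge0.
have lYn n : linear (Yn n).
  elim: n => [|n IHn] a x y; first by rewrite scaler0 addr0.
  rewrite !YnS lX !IHn addrACA -scalerDr [LHS]scalerDr; congr (_ + _).
  by rewrite !scalerA mulrC.
have Ynq n x : nrm (Yn n x) <= q * nrm x.
  elim: n x => [|n IHn] x; first by rewrite nrm0 mulr_ge0 ?nrm_ge0.
  rewrite YnS nrmZ half2 mulrC ler_pdivrMr//.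
  apply: (le_trans (nrmD _ _)); rewrite mulr_natr mulr2n lerD//.
  apply: (le_trans (IHn _)); rewrite -[leRHS]mul1r.
  by apply: ler_pM => //; rewrite ?nrm_ge0// ltW.
have sYn n : adjoint (Yn n) (Yn n).
  elim: n => [|n IHn] x y; first by rewrite inner0l inner0r.
  rewrite !YnS innerZl innerZr innerDl innerDr sX !IHn.
  by rewrite fmorphV rmorph_nat.
have dYn n x : nrm (Yn n.+1 x - Yn n x) <= nrm x * q ^+ n.
  elim: n x => [|n IHn] x.
    rewrite expr0 mulr1 subr0; apply: (le_trans (Ynq 1%N x)).
    by rewrite ler_piMl ?nrm_ge0// ltW.
  rewrite [Yn n.+2 x]YnS [in X in _ - X]YnS -scalerBr nrmZ half2.
  rewrite mulrC ler_pdivrMr// opprD addrACA subrr add0r.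
  rewrite mulr_natr mulr2n exprS.
  apply: (le_trans (nrm_dist _ (Yn n.+1 (Yn n x)) _)); apply: lerD.
    rewrite -(linB (lYn n.+1)); apply: (le_trans (Ynq _ _)).
    by rewrite mulrCA ler_wpM2l.
  apply: (le_trans (IHn _)); rewrite mulrA ler_wpM2r ?exprn_ge0//.
  by rewrite mulrC.
have /choice[Y YP] x : exists l, Yn^~ x @ \oo --> l /\
    forall n, nrm (l - Yn n x) <= nrm x / (1 - q) * q ^+ n.
  by have [l ul le] := geom_cvg q0 q1 (fun n => dYn n x); exists l.
have cY x : Yn^~ x @ \oo --> Y x by have [] := YP x.
have lY : linear Y.
  move=> a x y; apply: (nrm_cvg_unique (cY _)).
  have -> : Yn^~ (a *: x + y) = (fun n => a *: Yn n x + Yn n y).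
    by apply/funext => n; rewrite lYn.
  by apply: cvgD => //; apply: cvgZr.
have Yq x : nrm (Y x) <= q * nrm x.
  rewrite -nrmN -sub0r; apply: (le_nrm_lim (cY x)); exists 0%N => n _.
  by rewrite sub0r nrmN.
have q1' : 0 < (1 - q)^-1 by rewrite invr_gt0 subr_gt0.
exists Y; split=> //.
- move=> x y.
  apply: (@cvg_unique _ (@norm_hausdorff _ R[i]^o) _ _ _ _ (inner_cvg (cY x))).
  have -> : (fun n => inner (Yn n x) y) = (fun n => Num.conj (inner (Yn n y) x)).
    by apply/funext => n; rewrite sYn innerC.
  rewrite innerC; apply/(@nrm_cvgP _ R[i]^o) => e e0.
  have /(@nrm_cvgP _ R[i]^o)/(_ e e0)[N NP] := inner_cvg (y := x) (cY y).
  by exists N => n Nn; rewrite -rmorphB nrm_conj; exact: NP.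
- move=> x; apply: (nrm_cvg_unique (cY x)); apply/nrm_cvgP => e e0.
  have [N NP] := geom_eventually (2 * (nrm x / (1 - q))) q0 q1 e0.
  exists N.+1 => -[//|n] Nn; rewrite YnS -scalerBr nrmZ half2.
  rewrite mulrC ler_pdivrMr// opprD addrACA subrr add0r.
  apply: (le_trans (nrm_dist _ (Yn n (Y x)) _)).
  rewrite -(linB (lYn n)); have [_ h1] := YP (Y x); have [_ h2] := YP x.
  have h3 : nrm (Y x) / (1 - q) * q ^+ n <= nrm x / (1 - q) * q ^+ n.
    rewrite ler_wpM2r ?exprn_ge0// ler_pM2r//; apply: (le_trans (Yq x)).
    by rewrite ler_piMl ?nrm_ge0// ltW.
  have h4 : nrm (Yn n (Y x - Yn n x)) <= nrm x / (1 - q) * q ^+ n.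
    apply: (le_trans (Ynq _ _)); apply: le_trans (h2 n).
    by rewrite ler_piMl ?nrm_ge0// ltW.
  have := lerD (le_trans (h1 n) h3) h4; move/le_trans; apply.
  have := NP n Nn; rewrite mulr_natr mulr2n; have := ltW e0; lra.
- move=> C bC CX; have [lC _] := bC.
  have CX' x : C (X x) = X (C x) by have := congr1 (@^~ x) CX.
  have CYn n x : C (Yn n x) = Yn n (C x).
    elim: n x => [|n IHn] x; first by rewrite (lin0 lC).
    by rewrite !YnS (linZ lC) (linD lC) CX' !IHn.
  apply/funext => x /=; apply: (nrm_cvg_unique (bounded_cvg bC (cY x))).
  have -> : C \o Yn^~ x = Yn^~ (C x) by apply/funext => n; exact: CYn.
  exact: cY.
Qed.

Lemma coercive_sqrt A : coercive A -> exists B,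
  [/\ coercive B, B \o B = A &
    forall C, bounded_operator C -> C \o A = A \o C -> C \o B = B \o C].
Proof.
move=> cA; have [M [q [M0 q0 q1 Xq]]] := coercive_scaled cA.
have [pA _] := cA; have [[lA _] _] := pA.
pose X x := x - M^-1%:C *: A x.
have lX : linear X by exact: linear_id_sub.
have sX : adjoint X X.
  move=> x y; rewrite innerBl innerBr innerZl innerZr (positive_adjoint pA).
  by rewrite conjR.
have [Y [lY sY Yq YE YC]] := sqrt_near_id lX sX q0 q1 Xq.
pose s := Num.sqrt M; have s0 : 0 < s by rewrite sqrtr_gt0.
have sM : s%:C * s%:C = M%:C :> R[i].
  by rewrite -rmorphM /= -expr2 sqr_sqrtr// ltW.
pose B x := s%:C *: (x - Y x).
have bY : bounded_operator Y.
  apply/bounded_operatorP; split=> //; exists 1 => // x; rewrite mul1r.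
  by apply: (le_trans (Yq x)); rewrite ler_piMl ?nrm_ge0// ltW.
have bY1 : bounded_operator (fun x => x - Y x).
  have := bounded_id_sub 1 bY; congr bounded_operator.
  by apply/funext => x; rewrite scale1r.
have bB : bounded_operator B by exact: bounded_scale.
have rB x : s * (1 - q) * nrm x ^+ 2 <= rdot (B x) x.
  rewrite rdotZl -mulrA ler_pM2l// rdotDl rdotNl rdotxx mulrBl mul1r lerB//.
  apply: (le_trans (ler_norm _)); apply: (le_trans (rdot_le _ _)).
  by rewrite expr2 mulrA ler_wpM2r ?nrm_ge0.
have sq : 0 < s * (1 - q) by rewrite mulr_gt0// subr_gt0.
exists B; split.
- split; last by exists (s * (1 - q)).
  split=> // x; rewrite lecE; apply/andP; split; last first.
    by apply: le_trans (rB x); rewrite mulr_ge0 ?exprn_ge0 ?nrm_ge0// ltW.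
  have : inner (B x) x = Num.conj (inner (B x) x).
    rewrite -innerC innerZl innerZr innerBl innerBr sY.
    by rewrite conjR.
  case: (inner (B x) x) => u v /= [/eqP]; rewrite -addr_eq0 -mulr2n.
  by rewrite mulrn_eq0.
- apply/funext => x /=; rewrite /B.
  have [lY1 _] := bY1; rewrite (linZ lY1) scalerA sM (linB lY).
  have -> : x - Y x - (Y x - Y (Y x)) = x - (Y x *+ 2 - Y (Y x)).
    by rewrite -addrA -opprD addrA -mulr2n.
  have -> : Y x *+ 2 = X x + Y (Y x).
    rewrite YE -scaler_nat scalerA mulfV ?pnatr_eq0// scale1r.
    by rewrite -YE.
  rewrite addrK /X opprB addrC subrK scalerA -rmorphM /= mulfV ?gt_eqF//.
  by rewrite scale1r.
- move=> C bC CA; have [lC _] := bC.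
  have CA' x : C (A x) = A (C x) by have := congr1 (@^~ x) CA.
  have /(YC C bC) CY : C \o X = X \o C.
    by apply/funext => x /=; rewrite /X (linB lC) (linZ lC) CA'.
  have CY' x : C (Y x) = Y (C x) by have := congr1 (@^~ x) CY.
  by apply/funext => x /=; rewrite /B (linZ lC) (linB lC) CY'.
Qed.

(** Any positive square root commutes with its square [A], hence with the one
    built above; the difference of two commuting roots is annihilated by their
    sum, which is injective. *)
Lemma sqrt_opP A : coercive A ->
  coercive (sqrt_op A) /\ sqrt_op A \o sqrt_op A = A.
Proof.
move=> cA; have [B [cB BB BC]] := coercive_sqrt cA.
suff -> : sqrt_op A = B by [].
have [pB [b b0 Bb]] := cB; have [[lB _] _] := pB.
apply: xget_unique => // C [[bC C0] CC].
have [lC _] := bC.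
have CB : C \o B = B \o C by apply: BC => //; rewrite -CC.
have CB' x : C (B x) = B (C x) by have := congr1 (@^~ x) CB.
have CCB x : C (C x) = B (B x).
  by have := congr1 (@^~ x) CC; have := congr1 (@^~ x) BB => /= -> ->.
apply/funext => x; apply/eqP; rewrite -subr_eq0; apply/eqP.
(* [(B + C) (C - B) x = 0] by commutation, and [B + C] is bounded below. *)
set y := C x - B x.
have y0 : B y + C y = 0.
  rewrite /y (linB lB) (linB lC) CB' CCB addrC addrA subrK subrr.
  by [].
have : rdot (B y) y + rdot (C y) y = 0 by rewrite -rdotDl y0 /rdot inner0l.
have : 0 <= rdot (C y) y by have := C0 y; rewrite lecE => /andP[].
have := Bb y => h1 h2 h3.
have : nrm y ^+ 2 <= 0 by rewrite -(pmulr_rle0 _ b0); lra.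
move=> h; apply/nrm0_eq0/eqP.
by rewrite -sqrf_eq0 eq_le h sqr_ge0.
Qed.

End SquareRoot.

(** * Projections, adjoints, uniqueness of reproducing kernel spaces *)

Section Projection.
Context {R : realType} {H : hilbertType R}.
Implicit Types (x y z h p : H).

Definition subspace (C : set H) :=
  C 0 /\ forall a x y, C x -> C y -> C (a *: x + y).

(** A minimizing sequence for the distance from a point to a subspace is Cauchy
    by the parallelogram identity. The subspace is not assumed closed, so the
    conclusion keeps the sequence, which converges at a geometric rate. *)
Lemma orth_projection (C : set H) x : subspace C ->
  exists (u : nat -> H) p, [/\ forall n, C (u n), u @ \oo --> p,
    forall n, nrm (u n.+1 - u n) <= 2 * 2^-1 ^+ n &
    forall h, C h -> inner (x - p) h = 0].
Proof.
move=> [C0 CL].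
have CZ a y : C y -> C (a *: y) by move=> Cy; rewrite -[_ *: _]addr0; exact: CL.
pose D := [set nrm (x - c) ^+ 2 | c in C].
have hD : has_inf D.
  split; first by exists (nrm (x - 0) ^+ 2), 0.
  by exists 0 => _ [c _ <-]; rewrite exprn_ge0 ?nrm_ge0.
pose d := inf D.
have dC c : C c -> d <= nrm (x - c) ^+ 2.
  by move=> Cc; apply: ge_inf; [case: hD|exists c].
have h0 : (0 : R) <= 2^-1 by rewrite invr_ge0.
have h1 : (2^-1 : R) < 1 by rewrite invf_lt1// ltr1n.
have h00 : (0 : R) < 2^-1 by rewrite invr_gt0.
have /choice[u uP] n : exists c, C c /\ nrm (x - c) ^+ 2 <= d + (2^-1 ^+ n) ^+ 2.
  have e0 : (0 : R) < (2^-1 ^+ n) ^+ 2 by rewrite !exprn_gt0.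
  by have [_ [c Cc <-] /ltW] := inf_adherent e0 hD; exists c.
have Cu n : C (u n) by have [] := uP n.
have half : (2^-1 : R[i]) = (2^-1)%:C by rewrite fmorphV rmorph_nat.
have u_geom n : nrm (u n.+1 - u n) <= 2 * 2^-1 ^+ n.
  have := dC (2^-1 *: u n + 2^-1 *: u n.+1) (CL _ _ _ (Cu _) (CZ _ _ (Cu _))).
  have [_ un] := uP n; have [_ un1] := uP n.+1.
  (* parallelogram identity; the midpoint of two approximants lies in [C] *)
  have pl : nrm (u n.+1 - u n) ^+ 2
      + 4 * nrm (x - (2^-1 *: u n + 2^-1 *: u n.+1)) ^+ 2 =
      2 * nrm (x - u n) ^+ 2 + 2 * nrm (x - u n.+1) ^+ 2.
    rewrite half !nrmBsqr -[nrm (2^-1%:C *: _ + _) ^+ 2]rdotxx.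
    rewrite !rdotDr !rdotDl !rdotZl !rdotZr !rdotxx [rdot (u n) (u n.+1)]rdotC.
    by field.
  move=> dm; rewrite -(@ler_pXn2r _ 2)// ?nnegrE ?nrm_ge0 ?mulr_ge0 ?exprn_ge0//.
  move: un un1; rewrite (exprSr _ n) !exprMn; set s := 2^-1 ^+ n ^+ 2 => un un1.
  have s0 : 0 <= s by rewrite !exprn_ge0.
  by lra.
have [p up _] := geom_cvg h0 h1 u_geom.
have pC h : C h -> nrm (x - p) <= nrm (x - p - h).
  move=> Ch; apply/ler_addgt0Pr => e e0.
  have e3 : 0 < e / 3 by rewrite divr_gt0.
  have /nrm_cvgP/(_ _ e3)[N NP] := up.
  have [N' N'P] := geom_eventually 1 h0 h1 e3.
  pose n := maxn N N'; have pn := NP n (leq_maxl _ _).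
  have := N'P n (leq_maxr _ _); rewrite mul1r; set s := _ ^+ n => s3.
  have s0 : 0 <= s by rewrite exprn_ge0.
  have unh : nrm (x - u n) <= nrm (x - u n - h) + s.
    rewrite -(@ler_pXn2r _ 2)// ?nnegrE ?nrm_ge0 ?addr_ge0 ?nrm_ge0//.
    have [_ /le_trans->//] := uP n.
    have : d <= nrm (x - u n - h) ^+ 2.
      have -> : x - u n - h = x - (1 *: h + u n).
        by rewrite scale1r [h + _]addrC opprD addrA.
      by apply: dC; exact: CL.
    rewrite sqrrD -/s => dx; have := nrm_ge0 (x - u n - h) => n0.
    have : 0 <= nrm (x - u n - h) * s by rewrite mulr_ge0.
    by rewrite mulr2n; lra.
  have t1 := nrm_dist x (u n) p; rewrite [nrm (u n - p)]nrmC in t1.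
  have t2 : nrm (x - u n - h) <= nrm (x - p - h) + nrm (p - u n).
    have -> : x - u n - h = (x - p - h) + (p - u n).
      by rewrite addrAC -[in RHS](addrAC x) addrA subrK.
    exact: nrmD.
  by lra.
have pO h : C h -> rdot (x - p) h = 0.
  move=> Ch; apply/eqP; rewrite -sqrf_eq0 eq_le sqr_ge0 andbT.
  rewrite -(mul0r (nrm h ^+ 2)); apply: discriminant_le => [|t].
    by rewrite exprn_ge0 ?nrm_ge0.
  have := pC (- t%:C *: h) (CZ _ _ Ch); set v := x - p.
  rewrite -(@ler_pXn2r _ 2)// ?nnegrE ?nrm_ge0// scaleNr opprK (nrmDsqr v).
  rewrite rdotZr nrmZ nrmR exprMn real_normK ?num_real//.
  by lra.
exists u, p; split=> // h Ch; rewrite inner_rdot rdotZi !pO//; last exact: CZ.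
by rewrite rmorph0 mulr0 addr0.
Qed.

End Projection.

Section Adjoint.
Context {R : realType}.
Implicit Types H : hilbertType R.

(** Riesz representation: the functional is represented by a multiple of the
    component, orthogonal to its kernel, of a vector on which it does not
    vanish. *)
Lemma riesz H (f : H -> R[i]) (M : R) :
  (forall a x y, f (a *: x + y) = a * f x + f y) ->
  (forall x, nrm (f x) <= M * nrm x) -> exists v, forall x, f x = inner x v.
Proof.
move=> lf fM.
have [f0|/existsNP[x0 fx0]] := pselect (forall x, f x = 0).
  by exists 0 => x; rewrite inner0r f0.
have f0 : f 0 = 0.
  have := lf 1 0 0; rewrite scale1r mul1r addr0 => /eqP.
  by rewrite -subr_eq0 opprD addrA subrr sub0r oppr_eq0 => /eqP.
have ker_f : subspace [set x | f x = 0].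
  by split=> [//|a x y /= fx fy]; rewrite lf fx fy mulr0 addr0.
have fB x y : f (x - y) = f x - f y.
  by rewrite addrC -scaleN1r lf mulN1r addrC.
have [u [p [fu up _ vO]]] := orth_projection x0 ker_f.
have fp : f p = 0.
  apply: nrm_le0_eq0; apply/ler_addgt0Pr => e e0; rewrite add0r.
  have M1 : 0 < `|M| + 1 by rewrite ltr_wpDl.
  have /nrm_cvgP/(_ _ (divr_gt0 e0 M1))[N /(_ N (leqnn N))] := up.
  rewrite ler_pdivlMr// => uN.
  rewrite -[f p]subr0 -(fu N) -fB; apply: (le_trans (fM _)).
  apply: le_trans uN; rewrite mulrC ler_wpM2l ?nrm_ge0//.
  by rewrite (le_trans (ler_norm _))// lerDl.
set v := x0 - p in vO; have fv : f v = f x0 by rewrite fB fp subr0.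
have v0 : inner v v != 0.
  rewrite inner_nrm; apply/eqP => /(@complexI R _ 0)/eqP; rewrite sqrf_eq0 => /eqP.
  by move=> /nrm0_eq0 v0; apply: fx0; rewrite -fv v0.
exists (Num.conj (f v / inner v v) *: v) => x.
rewrite innerZr conjCK.
have : inner v (f v *: x - f x *: v) = 0.
  apply: vO; rewrite /= fB -[_ *: x]addr0 -[_ *: v]addr0 !lf f0 !addr0.
  by rewrite mulrC subrr.
move/(congr1 Num.conj); rewrite -innerC rmorph0 innerBl !innerZl => /eqP.
by rewrite subr_eq0 => /eqP vE; rewrite mulrAC vE mulfK.
Qed.

Lemma adjoint_exists H (T : H -> H) : bounded_operator T ->
  exists S, bounded_operator S /\ adjoint T S.
Proof.
move=> /bounded_operatorP[lT [M M0 TM]].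
have /choice[S TS] y : exists v, forall x, inner (T x) y = inner x v.
  apply: (@riesz _ (fun x => inner (T x) y) (M * nrm y)).
    by move=> a x x'; rewrite lT innerDl innerZl.
  move=> x; apply: (le_trans (inner_le _ _)); rewrite mulrAC.
  by rewrite ler_wpM2r ?nrm_ge0.
have aTS : adjoint T S by move=> x y; exact: TS.
exists S; split=> //; apply/bounded_operatorP; split.
  move=> a x y; apply: inner_inj => z; rewrite innerDl innerZl.
  by rewrite !(adjoint_sym aTS) innerDl innerZl.
exists M => // x; have [Sx0|Sx0] := eqVneq (S x) 0.
  by rewrite Sx0 nrm0 mulr_ge0 ?nrm_ge0// ltW.
rewrite -(ler_pM2l (nrm_gt0 Sx0)) -expr2 -rdotxx /rdot -aTS -/(rdot _ _).
apply: (le_trans (ler_norm _)); apply: (le_trans (rdot_le _ _)).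
by rewrite mulrA [nrm (S x) * M]mulrC ler_wpM2r ?nrm_ge0.
Qed.

Lemma adj_op_eq H (T S : H -> H) :
  bounded_operator S -> adjoint T S -> adj_op T = S.
Proof.
move=> bS TS; apply: xget_unique => // S' [_ TS'].
exact: adjoint_uniq TS' TS.
Qed.

Lemma adj_opP H (T : H -> H) : bounded_operator T ->
  bounded_operator (adj_op T) /\ adjoint T (adj_op T).
Proof. by move=> /adjoint_exists[S [bS TS]]; rewrite (adj_op_eq bS TS). Qed.

End Adjoint.

Section RKHSUniqueness.
Context {R : realType}.

(** An element of one space and an element of the other are matched when they
    are the same function and when they pair identically with any two other
    representatives of a common function. Matched pairs contain the kernel
    functions and form a subspace that is isometric, hence closed; kernel
    functions are total, so every element is matched. *)
Lemma rkhs_match (E H1 H2 : hilbertType R) (Omega : set R[i]) (F : set E)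
    (k : R[i] -> R[i] -> E -> E) (ev1 : H1 -> R[i] -> E) (ev2 : H2 -> R[i] -> E) :
  is_rkhs Omega F k ev1 -> is_rkhs Omega F k ev2 ->
  forall x, exists y, (forall z, Omega z -> ev2 y z = ev1 x z) /\ nrm y = nrm x.
Proof.
move=> K1 K2.
pose same f g := forall z, Omega z -> ev2 g z = ev1 f z.
pose Q x y := same x y /\ forall f g, same f g -> inner f x = inner g y.
have QL a x y x' y' : Q x y -> Q x' y' -> Q (a *: x + x') (a *: y + y').
  move=> [xy Ixy] [xy' Ixy']; split=> [z Oz|f g fg].
    by rewrite (rkhs_linear K1 Oz) (rkhs_linear K2 Oz) xy ?xy'.
  by rewrite !innerDr !innerZr (Ixy _ _ fg) (Ixy' _ _ fg).
have Q00 : Q 0 0.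
  split=> [z Oz|f g _]; last by rewrite !inner0r.
  by rewrite (lin0 (rkhs_linear K1 Oz)) (lin0 (rkhs_linear K2 Oz)).
have Qk w eta : Omega w -> F eta -> exists x y,
    [/\ Q x y, forall f, inner f x = inner (ev1 f w) eta
      & forall g, inner g y = inner (ev2 g w) eta].
  move=> Ow Feta.
  have [x xE xR] := rkhs_kernel K1 Ow Feta.
  have [y yE yR] := rkhs_kernel K2 Ow Feta.
  exists x, y; split=> //; split=> [z Oz|f g fg]; first by rewrite xE ?yE.
  by rewrite xR yR fg.
have Qnrm x y : Q x y -> nrm y = nrm x.
  move=> [xy /(_ x y xy)]; rewrite !inner_nrm => /(@complexI R)/eqP.
  by rewrite eqrXn2 ?nrm_ge0// => /eqP.
pose C := [set x | exists y, Q x y].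
have sC : subspace C.
  split; first by exists 0.
  by move=> a x x' [y xy] [y' xy']; exists (a *: y + y'); exact: QL.
move=> x; have [u [p [Cu up ug xpO]]] := orth_projection x sC.
have /choice[v uv] n : exists y, Q (u n) y by exact: Cu.
have vg n : nrm (v n.+1 - v n) <= 2 * 2^-1 ^+ n.
  apply: le_trans (ug n); rewrite le_eqVlt; apply/orP; left; apply/eqP.
  have := QL (-1) _ _ _ _ (uv n) (uv n.+1).
  by rewrite !scaleN1r ![- _ + _]addrC => /Qnrm.
have h0 : (0 : R) <= 2^-1 by rewrite invr_ge0.
have h1 : (2^-1 : R) < 1 by rewrite invf_lt1// ltr1n.
have [q vq _] := geom_cvg h0 h1 vg.
have limE f g : same f g -> inner f p = inner g q.
  move=> fg; rewrite innerC [RHS]innerC; congr Num.conj.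
  apply: (@cvg_unique _ (@norm_hausdorff _ R[i]^o) _ _ _ _ (inner_cvg up)).
  have -> : (fun n => inner (u n) f) = (fun n => inner (v n) g).
    apply/funext => n; have [_ Iuv] := uv n.
    by rewrite innerC (Iuv _ _ fg) -innerC.
  exact: inner_cvg.
have Qpq : Q p q.
  split=> // w Ow; apply/eqP; rewrite -subr_eq0; apply/eqP.
  set d := _ - _.
  have dO eta : F eta -> inner d eta = 0.
    move=> /(Qk _ _ Ow)[f [g [[fg _] fR gR]]].
    by rewrite innerBl -fR -gR innerC -(limE _ _ fg) -innerC subrr.
  apply: nrm0_eq0; apply/eqP; rewrite -sqrf_eq0 -rdotxx /rdot {2}/d.
  rewrite innerBr !dO ?subrr//.
    exact: (rkhs_val K1).
  exact: (rkhs_val K2).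
have -> : x = p.
  apply/eqP; rewrite -subr_eq0; apply/eqP/(rkhs_inj K1) => w Ow.
  have Fw := rkhs_val K1 (x - p) Ow.
  have [f [g [Qfg fR _]]] := Qk _ _ Ow Fw.
  have : inner (x - p) f = 0 by apply: xpO; exists g.
  rewrite fR inner_nrm => /(@complexI R _ 0)/eqP.
  by rewrite sqrf_eq0 => /eqP/nrm0_eq0.
by exists q; split; [case: Qpq|exact: Qnrm].
Qed.

(** An element is determined by the function it represents, so the matching is
    a linear map; exchanging the two spaces shows that it is onto. *)
Lemma rkhs_unitary (E H1 H2 : hilbertType R) (Omega : set R[i]) (F : set E)
    (k : R[i] -> R[i] -> E -> E) (ev1 : H1 -> R[i] -> E) (ev2 : H2 -> R[i] -> E) :
  is_rkhs Omega F k ev1 -> is_rkhs Omega F k ev2 ->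
  exists2 V : H1 -> H2, unitary_operator V &
    forall x z, Omega z -> ev2 (V x) z = ev1 x z.
Proof.
move=> K1 K2; have /choice[V VP] := rkhs_match K1 K2.
have ev2_inj g g' : (forall z, Omega z -> ev2 g z = ev2 g' z) -> g = g'.
  move=> gg'; apply/eqP; rewrite -subr_eq0; apply/eqP/(rkhs_inj K2) => z Oz.
  by rewrite (linB (rkhs_linear K2 Oz)) gg'// subrr.
have VE x z : Omega z -> ev2 (V x) z = ev1 x z by have [+ _] := VP x; exact.
have Vn x : nrm (V x) = nrm x by have [] := VP x.
have lV : linear V.
  move=> a x y; apply: ev2_inj => z Oz.
  by rewrite (rkhs_linear K2 Oz) !VE// (rkhs_linear K1 Oz).
exists V => //; split.
- by apply/bounded_operatorP; split=> //; exists 1 => // x; rewrite mul1r Vn.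
- move=> x y.
  have Vr a b : rdot (V a) (V b) = rdot a b.
    by have := nrmDsqr (V a) (V b); rewrite -(linD lV) !Vn nrmDsqr; lra.
  by rewrite inner_rdot [RHS]inner_rdot -(linZ lV) !Vr.
- move=> y; have [x [xy _]] := rkhs_match K2 K1 y; exists x.
  by apply: ev2_inj => z Oz; rewrite VE// xy.
Qed.

End RKHSUniqueness.

(** * Power series and the identity theorem *)

Section PowerSeries.
Context {R : realType} {V : completeNormedModType R[i]}.
Implicit Types (c : nat -> V) (f : R[i] -> V) (h : R[i]).

Definition power_series c (r : R) f :=
  forall h, nrm h < r -> series (fun j => h ^+ j *: c j) @ \oo --> f h.

(** Vanishing to infinite order along some points tending to 0: zeros that
    accumulate at 0 and divisibility by all powers of the variable both
    provide it. *)
Definition flat f := forall (m : nat) (e : R), 0 < e ->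
  exists h, [/\ h != 0, nrm h < e & nrm (f h) <= e * nrm h ^+ m].

Lemma series_term_bound (u : nat -> V) (l : V) : series u @ \oo --> l ->
  exists2 M : R, 0 <= M & forall n, nrm (u n) <= M.
Proof.
move=> /nrm_cvgP/(_ 1 ltr01)[N NP].
have S0 : 0 <= \sum_(j < N) nrm (u j) by apply: sumr_ge0 => j _; exact: nrm_ge0.
exists (2 + \sum_(j < N) nrm (u j)); first by rewrite addr_ge0.
move=> n; have [nN|Nn] := ltnP n N.
  rewrite (bigD1 (Ordinal nN)) //= addrCA lerDl addr_ge0// sumr_ge0// => j _.
  exact: nrm_ge0.
have -> : u n = (l - series u n) - (l - series u n.+1).
  by rewrite opprB [RHS]addrC subrKA seriesSr [RHS]addrC addKr.
apply: (le_trans (nrmB _ _)); have := NP n Nn; have := NP n.+1 (leqW Nn).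
by lra.
Qed.

(** The terms are bounded at a point of modulus [p < r], so at modulus at most
    [p / 2] they decay geometrically, with a factor proportional to [nrm h]. *)
Lemma power_series_near0 c r f : 0 < r -> power_series c r f ->
  exists K d : R, [/\ 0 <= K, 0 < d, d <= r &
    forall h, nrm h < d -> nrm (f h - c 0%N) <= K * nrm h].
Proof.
move=> r0 cf; have [p p0 pr] : exists2 p, 0 < p & p < r.
  by exists (r / 2); lra.
have np : nrm (p%:C) = p by rewrite nrmR gtr0_norm.
have [|M M0 Mp] := series_term_bound (cf p%:C _); first by rewrite np.
have pd : 0 < p / 2 by rewrite divr_gt0.
exists (2 * M / p), (p / 2); split=> //.
- by apply: divr_ge0; [exact: mulr_ge0|exact: ltW].
- by lra.
move=> h hp.
have hr : nrm h < r by lra.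
pose u n := series (fun j => h ^+ j *: c j) n.+1.
have cu : u @ \oo --> f h.
  apply/nrm_cvgP => e e0; have /nrm_cvgP/(_ e e0)[N NP] := cf h hr.
  by exists N => n Nn; apply: NP; exact: leqW.
pose t := nrm h / p.
have t0 : 0 <= t by rewrite divr_ge0 ?nrm_ge0// ltW.
have t2 : t <= 2^-1 by rewrite ler_pdivrMr//; have := ltW hp; lra.
have ug n : nrm (u n.+1 - u n) <= M * t * 2^-1 ^+ n.
  have -> : u n.+1 - u n = h ^+ n.+1 *: c n.+1.
    by rewrite /u seriesSr [LHS]addrC addKr.
  have -> : nrm (h ^+ n.+1 *: c n.+1) = nrm (p%:C ^+ n.+1 *: c n.+1) * t ^+ n.+1.
    rewrite !nrmZ !nrmcX np /t expr_div_n [RHS]mulrAC; congr (_ * _).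
    by rewrite mulrCA mulfV ?mulr1// expf_neq0// gt_eqF.
  rewrite (exprS t) -[leRHS]mulrA; apply: ler_pM => //.
  - exact: nrm_ge0.
  - by rewrite mulr_ge0// exprn_ge0.
  - by rewrite ler_wpM2l// lerXn2r// nnegrE// invr_ge0.
have h0 : (0 : R) <= 2^-1 by rewrite invr_ge0.
have h1 : (2^-1 : R) < 1 by rewrite invf_lt1// ltr1n.
have [l ul /(_ 0%N)] := geom_cvg h0 h1 ug.
rewrite (nrm_cvg_unique ul cu) expr0 mulr1 /u /series /= big_nat1 expr0 scale1r.
move/le_trans; apply; rewrite le_eqVlt; apply/orP; left; apply/eqP.
by rewrite /t; field; rewrite gt_eqF//= ; lra.
Qed.

(** Removing the constant term and dividing by the variable lowers the order
    of vanishing by one, so the coefficients vanish one after the other. *)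
Lemma power_series_flat c r f : 0 < r -> power_series c r f -> flat f ->
  forall j, c j = 0.
Proof.
move=> r0.
have head0 c' f' : power_series c' r f' -> flat f' -> c' 0%N = 0.
  move=> cf ff; have [K [d [K0 d0 _ fK]]] := power_series_near0 r0 cf.
  apply: nrm_le0_eq0; apply/ler_addgt0Pr => e e0; rewrite add0r.
  have K1 : 0 < K + 1 by rewrite ltr_wpDl.
  pose e' := Num.min d (e / (K + 1)).
  have e'0 : 0 < e' by rewrite lt_min d0 divr_gt0.
  have [h [h0 he]] := ff 0%N e' e'0; rewrite expr0 mulr1 => fh.
  have hd : nrm h < d by apply: lt_le_trans he _; rewrite ge_min lexx.
  have ee : e' * (K + 1) <= e by rewrite -ler_pdivlMr// ge_min lexx orbT.
  have := fK h hd; have := nrm_split (c' 0%N) (f' h); rewrite nrmC.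
  have : K * nrm h <= K * e' by rewrite ler_wpM2l// ltW.
  by lra.
move=> + + j; elim: j c f => [|j IHj] c f cf ff; first exact: head0 cf ff.
have c0 := head0 _ _ cf ff.
pose c1 i := c i.+1.
pose f1 h := if h == 0 then c 1%N else h^-1 *: f h.
apply: (IHj c1 f1) => [h hr|m e e0]; last first.
  have [h [h0 he fh]] := ff m.+1 e e0; exists h; split=> //.
  rewrite /f1 (negbTE h0) nrmZ nrmcV mulrC ler_pdivrMr ?nrm_gt0//.
  by rewrite -mulrA -exprSr.
rewrite /f1; have [->|h0] := eqVneq h 0.
  apply/nrm_cvgP => e e0; exists 1%N => -[//|n] _.
  rewrite /series /= big_nat_recl// expr0 scale1r big1 ?addr0 ?subrr ?nrm0 ?ltW//.
  by move=> i _; rewrite exprS mul0r scale0r.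
apply/nrm_cvgP => e e0.
have eh : 0 < e * nrm h by rewrite mulr_gt0 ?nrm_gt0.
have /nrm_cvgP/(_ _ eh)[N NP] := cf h hr; exists N => n Nn.
have := NP n.+1 (leqW Nn); rewrite /series /= big_nat_recl// c0 scaler0 add0r.
have -> : \sum_(0 <= i < n) h ^+ i.+1 *: c i.+1 =
          h *: \sum_(0 <= i < n) h ^+ i *: c1 i.
  by rewrite scaler_sumr; apply: eq_bigr => i _; rewrite scalerA -exprS.
rewrite -{1}[f h]scale1r -(divff h0) -scalerA -scalerBr nrmZ mulrC.
by rewrite ler_pM2r ?nrm_gt0.
Qed.

End PowerSeries.

Section IdentityTheorem.
Context {R : realType} {E : hilbertType R}.
Implicit Types (f : R[i] -> E) (z a h : R[i]).

Lemma analytic_onP Omega f a : analytic_on Omega f -> Omega a ->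
  exists c (r : R), 0 < r /\ power_series c r (fun h => f (a + h)).
Proof.
move=> fO /fO[c [r [r0 cf]]]; exists c, (complex.Re r).
have rE : r = (complex.Re r)%:C by rewrite RRe_real// gtr0_real.
split=> [|h hr]; first by rewrite -ltcR -rE.
by apply: cf; rewrite nrmE rE ltcR.
Qed.

Lemma analytic_flat Omega f a : analytic_on Omega f -> Omega a ->
  flat (fun h => f (a + h)) ->
  exists2 r : R, 0 < r & forall h, nrm h < r -> f (a + h) = 0.
Proof.
move=> fO Oa ff; have [c [r [r0 cf]]] := analytic_onP fO Oa.
exists r => // h hr; have c0 := power_series_flat r0 cf ff.
apply: (nrm_cvg_unique (cf h hr)); apply/nrm_cvgP => e e0; exists 0%N => n _.
by rewrite /series /= big1 ?subrr ?nrm0 ?ltW// => i _; rewrite c0 scaler0.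
Qed.

Lemma unit_discE z : unit_disc z <-> nrm z < 1.
Proof. by rewrite /unit_disc /= nrmE -ltcR. Qed.

(** Along a radius, the zeros that fill the segment up to its last point
    accumulate there, so the function vanishes beyond that point too. *)
Lemma analytic_flat_disc f : analytic_on unit_disc f -> flat f ->
  forall z, unit_disc z -> f z = 0.
Proof.
move=> fD ff z /unit_discE z1.
have D0 : @unit_disc R 0 by apply/unit_discE; rewrite nrm0.
have ff0 : flat (fun h => f (0 + h)) by under eq_fun do rewrite add0r.
have [r0 r00 f0] := analytic_flat fD D0 ff0.
have f00 : f 0 = 0 by rewrite -(addr0 0) f0 ?nrm0.
have [->//|zN0] := eqVneq z 0.
have z0 := nrm_gt0 zN0.
pose S := [set t : R | t <= 1 /\
  forall s, 0 <= s -> s <= t -> f (s%:C * z) = 0].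
have S0 : S 0.
  split=> // s s0 s1; have -> : s = 0 by apply/eqP; rewrite eq_le s0 s1.
  by rewrite rmorph0 mul0r.
have hS : has_sup S by split; [exists 0|exists 1 => t []].
pose t := sup S.
have t0 : 0 <= t by apply: sup_upper_bound.
have t1 : t <= 1 by apply: ge_sup => [|s []//]; exists 0.
have ft s : 0 <= s -> s < t -> f (s%:C * z) = 0.
  move=> s0 st; have ts0 : 0 < t - s by rewrite subr_gt0.
  have [u [_ Su] su] := sup_adherent ts0 hS.
  by apply: Su => //; rewrite -/t opprB addrC subrK in su; exact: ltW.
have Dt : unit_disc (t%:C * z).
  apply/unit_discE; rewrite nrmcM nrmR ger0_norm//.
  by apply: le_lt_trans z1; rewrite ler_piMl// nrm_ge0.
have ftt : flat (fun h => f (t%:C * z + h)).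
  have [tE0|tN0] := eqVneq t 0.
    by rewrite tE0 rmorph0 mul0r.
  have tp : 0 < t by rewrite lt_neqAle eq_sym tN0.
  move=> m e e0; pose d := Num.min t e / 2.
  have me : 0 < Num.min t e by rewrite lt_min tp.
  have d0 : 0 < d by rewrite divr_gt0.
  have dt : d < t.
    have : Num.min t e <= t by rewrite ge_min lexx.
    by rewrite /d; lra.
  have de : d < e.
    have : Num.min t e <= e by rewrite ge_min lexx orbT.
    by rewrite /d; lra.
  exists (- d%:C * z); split.
  - rewrite mulf_neq0// oppr_eq0.
    by apply/eqP => /(@complexI R _ 0) d00; rewrite d00 ltxx in d0.
  - rewrite nrmcM nrmN nrmR gtr0_norm//; apply: lt_trans de.
    by rewrite gtr_pMr.
  - rewrite -mulrDl -rmorphB /= ft ?nrm0 ?mulr_ge0 ?exprn_ge0 ?nrm_ge0 ?ltW//.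
      by rewrite subr_gt0.
    by rewrite ltrBlDr ltrDl.
have [r rp fr] := analytic_flat fD Dt ftt.
pose t' := Num.min 1 (t + r / 2).
have St' : S t'.
  split; first by rewrite ge_min lexx.
  move=> s s0; rewrite le_min => /andP[s1 sr].
  have [st|ts] := ltP s t; first exact: ft.
  have -> : s%:C * z = t%:C * z + (s - t)%:C * z.
    by rewrite -mulrDl -rmorphD /= addrC subrK.
  apply: fr; rewrite nrmcM nrmR ger0_norm ?subr_ge0//.
  apply: (@le_lt_trans _ _ (s - t)); last by lra.
  by rewrite ler_piMr ?subr_ge0// ltW.
have t't : t' <= t by exact: sup_upper_bound.
have t1' : 1 <= t by move: t't; rewrite ge_min => /orP[//|]; lra.
have tE : t = 1 by apply/eqP; rewrite eq_le t1.
have [_ /(_ 1 ler01)] := St'; rewrite rmorph1 mul1r; apply.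
by rewrite le_min lexx tE; lra.
Qed.

(** An element that the shift divides infinitely often is a function with a
    zero of infinite order at the origin. *)
Lemma shift_analytic (F : set E) k (H : hilbertType R) (ev : H -> R[i] -> E)
    (S : H -> H) x :
  is_rkhs unit_disc F k ev -> is_shift unit_disc ev S ->
  (forall n, exists y, x = iter n S y) -> x = 0.
Proof.
move=> K [_ Sz] xS; apply: (rkhs_inj K).
apply: analytic_flat_disc; first exact: rkhs_analytic K x.
move=> m e e0; have [y xy] := xS m.+1.
have evn n z : unit_disc z -> ev (iter n S y) z = z ^+ n *: ev y z.
  move=> Dz; elim: n => [|n IHn]; first by rewrite scale1r.
  by rewrite iterS Sz// IHn scalerA exprS.
have D0 : @unit_disc R 0 by apply/unit_discE; rewrite nrm0.
have [c [r [r0 cf]]] := analytic_onP (rkhs_analytic K y) D0.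
have [K' [d [K0 d0 _ fK]]] := power_series_near0 r0 cf.
(* [M] bounds the values of [ev y] near 0, and [s * M <= e]: then
   [s ^+ m.+1 * M <= e * s ^+ m]. *)
pose M := K' + nrm (c 0%N) + 1.
have M1 : 1 <= M by rewrite lerDr addr_ge0 ?nrm_ge0.
have M0 : 0 < M by exact: lt_le_trans M1.
pose s := Num.min (Num.min d e) 1 / (2 * M).
have ms : 0 < Num.min (Num.min d e) 1 by rewrite !lt_min d0 e0 ltr01.
have s0 : 0 < s by rewrite divr_gt0// mulr_gt0.
have sM : s * (2 * M) = Num.min (Num.min d e) 1 by rewrite divfK// gt_eqF// mulr_gt0.
have s_le : s * (2 * M) <= d /\ s * (2 * M) <= e /\ s * (2 * M) <= 1.
  by rewrite sM !ge_min !lexx !orbT.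
have [sd [se s1]] := s_le.
have ssM : s <= s * M by rewrite ler_peMr// ltW.
have ns : nrm (s%:C) = s by rewrite nrmR gtr0_norm.
exists s%:C; split.
- by apply/eqP => /(@complexI R _ 0) s00; rewrite s00 ltxx in s0.
- by rewrite ns; lra.
- rewrite xy evn; last by apply/unit_discE; rewrite ns; lra.
  rewrite nrmZ nrmcX ns exprS mulrAC ler_wpM2r ?exprn_ge0 ?(ltW s0)//.
  have sd' : nrm s%:C < d by rewrite ns; lra.
  have := fK _ sd'; rewrite add0r ns => eys.
  have eyc := nrm_split (ev y s%:C) (c 0%N).
  have Ks : K' * s <= K' by rewrite ler_piMr//; lra.
  have : nrm (ev y s%:C) <= M by rewrite /M; lra.
  by move=> /(ler_wpM2l (ltW s0)); lra.
Qed.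

End IdentityTheorem.

(** * Resolvents and the analytic model *)

Section Resolvent.
Context {R : realType} {H : hilbertType R}.
Implicit Types (T S L : H -> H).

Lemma op_invertible_scale T (a : R[i]) : a != 0 ->
  op_invertible T -> op_invertible (fun x => a *: T x).
Proof.
move=> a0 [S [bS TS ST]]; exists (fun x => S (a^-1 *: x)); split.
- have [lS _] := bS; have := bounded_scale a^-1 bS; congr bounded_operator.
  by apply/funext => x; rewrite (linZ lS).
- by move=> x; rewrite scalerA mulVf// scale1r TS.
- by move=> x; rewrite ST scalerA mulfV// scale1r.
Qed.

Lemma op_inverse_adjoint T S T' S' : op_inverse T S ->
  bounded_operator S' -> adjoint T T' -> adjoint S S' -> op_inverse T' S'.
Proof.
move=> [_ TS ST] bS' /adjoint_sym TT' /adjoint_sym SS'; split=> // x.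
  by apply: inner_inj => y; rewrite SS' TT' ST.
by apply: inner_inj => y; rewrite TT' SS' TS.
Qed.

Lemma adjoint_id_sub (a : R[i]) T S : adjoint T S ->
  adjoint (fun x => x - a *: T x) (fun x => x - Num.conj a *: S x).
Proof.
by move=> TS x y; rewrite innerBl innerBr innerZl innerZr conjCK TS.
Qed.

Lemma spectrum_bounded L : bounded_operator L ->
  exists M : R, forall l, spectrum L l -> nrm l <= M.
Proof.
move=> /bounded_operatorP[lL [M M0 LM]]; exists M => l sl.
rewrite leNgt; apply/negP => Ml; apply: sl.
have l0 : l != 0.
  by apply/eqP => l0; move: Ml; rewrite l0 nrm0 ltNge ltW.
have nl : 0 < nrm l by exact: nrm_gt0.
have lX : linear (fun x => l^-1 *: L x).
  by move=> a x y; rewrite lL scalerDr !scalerA mulrC.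
have Xq x : nrm (l^-1 *: L x) <= M / nrm l * nrm x.
  by rewrite nrmZ nrmcV mulrC mulrAC ler_wpM2r// invr_ge0 ltW.
have := neumann_invertible lX _ _ Xq.
rewrite divr_ge0 ?(ltW M0) ?(ltW nl)// ltr_pdivrMr// mul1r => /(_ isT Ml).
have lN : - l != 0 by rewrite oppr_eq0.
move=> /(op_invertible_scale lN); congr op_invertible; apply/funext => x.
by rewrite scalerBr !scaleNr scalerA mulfV// scale1r opprK addrC.
Qed.

(** The points of the disc are 0 and the inverses of numbers larger in modulus
    than the whole spectrum. *)
Lemma resolvent_invertible L z : bounded_operator L ->
  disc_of_inv_radius (spectral_radius L) z ->
  op_invertible (fun x => x - z *: L x).
Proof.
move=> bL; rewrite /disc_of_inv_radius /= nrmE -rmorphM /= -(rmorph1 (real_complex R)).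
rewrite ltcR => rz; have [->|z0] := eqVneq z 0.
  exists id; split=> [|x|x]; [exact: bounded_id| |].
    by rewrite scale0r subr0.
  by rewrite scale0r subr0.
have nz := nrm_gt0 z0.
have : op_invertible (fun x => L x - z^-1 *: x).
  apply: contrapT => sz.
  have : nrm z^-1 <= spectral_radius L.
    have [M MP] := spectrum_bounded bL.
    apply: ub_le_sup; last by exists z^-1.
    by exists M => _ [l sl <-]; exact: MP.
  by rewrite nrmcV -(ler_pM2r nz) mulVf ?gt_eqF// leNgt rz.
have zN : - z != 0 by rewrite oppr_eq0.
move=> /(op_invertible_scale zN); congr op_invertible; apply/funext => x.
by rewrite scalerBr !scaleNr scalerA mulfV// scale1r opprK addrC.
Qed.

(** Around [a], the resolvent is a Neumann series in the operator
    [(I - a L)^-1 L]. *)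
Lemma resolvent_analytic L (P : H -> H) a x : bounded_operator L ->
  bounded_operator P -> op_invertible (fun y => y - a *: L y) ->
  exists (c : nat -> H) (r : R[i]), 0 < r /\ forall h, `|h| < r ->
    series (fun j => h ^+ j *: c j) @ \oo -->
      P (inv_op (fun y => y - (a + h) *: L y) x).
Proof.
move=> bL bP /inv_opP Ra; set Q := inv_op _ in Ra.
have [bQ QK KQ] := Ra; have [lQ _] := bQ; have [lP _] := bP.
have bQL : bounded_operator (Q \o L) by exact: bounded_comp.
have /bounded_operatorP[lX [M M0 XM]] := bQL.
pose X := Q \o L; rewrite -/X in lX XM.
exists (fun j => P (iter j X (Q x))), (M^-1%:C); split.
  by rewrite ltcR invr_gt0.
move=> h; rewrite nrmE ltcR => hM.
have q1 : nrm h * M < 1 by rewrite -ltr_pdivlMr// div1r.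
have q0 : 0 <= nrm h * M by rewrite mulr_ge0 ?nrm_ge0// ltW.
have lhX : linear (fun y => h *: X y).
  by move=> b y y'; rewrite lX scalerDr !scalerA mulrC.
have hXq y : nrm (h *: X y) <= nrm h * M * nrm y.
  by rewrite nrmZ -mulrA ler_wpM2l ?nrm_ge0.
have [N hN] := neumann_invertible lhX q0 q1 hXq.
have [_ _ hNK] := hN.
have -> : inv_op (fun y => y - (a + h) *: L y) = N \o Q.
  apply: inv_op_eq.
  have := op_inverse_comp Ra hN; congr (op_inverse _ _); apply/funext => y /=.
  have [lL _] := bL; rewrite (linB lL) (linZ lL).
  have hX : h *: X y = h *: L y + (a * h) *: L (X y).
    have -> : L y = X y - a *: L (X y) by rewrite /X /= KQ.
    by rewrite scalerBr scalerA [a * h]mulrC subrK.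
  rewrite hX scalerBr scalerA scalerDl !opprD opprK -!addrA; congr (_ + _).
  by rewrite [- (a *: L y) + _]addrC addKr addrC.
set s := N (Q x); have sE : s - h *: X s = Q x by exact: hNK.
have iterq n y : nrm (iter n (fun y => h *: X y) y) <= nrm y * (nrm h * M) ^+ n.
  elim: n => [|n IHn]; first by rewrite mulr1.
  by rewrite iterS (le_trans (hXq _))// exprS mulrCA ler_wpM2l.
have iterE n y : iter n (fun y => h *: X y) y = h ^+ n *: iter n X y.
  elim: n => [|n IHn]; first by rewrite scale1r.
  by rewrite !iterS IHn (linZ lX) scalerA -exprS.
have -> : series (fun j => h ^+ j *: P (iter j X (Q x))) =
    P \o (fun n => s - iter n (fun y => h *: X y) s).
  apply/funext => n; rewrite /= -(neumann_partial_sum s n lhX) sE.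
  rewrite (lin_sum lP n (fun j => iter j (fun y => h *: X y) (Q x))).
  rewrite /series /= big_mkord; apply: eq_bigr => j _.
  by rewrite iterE (linZ lP).
apply: bounded_cvg => //; apply/nrm_cvgP => e e0.
have [n0 n0P] := geom_eventually (nrm s) q0 q1 e0.
exists n0 => n n0n; rewrite opprB addrC subrK.
by apply: (le_trans (iterq _ _)); exact: n0P.
Qed.

End Resolvent.

Section ShimorinModel.
Context {R : realType} {H : hilbertType R} {T T' L : H -> H}.
Hypotheses (bT : bounded_operator T) (bL : bounded_operator L).
Hypotheses (TT' : adjoint T T') (TL : cancel T L).
Hypothesis defect : forall x, T' (x - T (L x)) = 0.

Let W := ker T'.
Let P x := x - T (L x).
Let Omega := disc_of_inv_radius (spectral_radius L).
Let res z := inv_op (fun x => x - z *: L x).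

(** [x - P x] lies in the range of [T], which is orthogonal to [W]. *)
Lemma shimorin_proj : proj_op W = P.
Proof.
have PO x w : W w -> inner (x - P x) w = 0.
  by move=> Ww; rewrite /P opprB addrC subrK TT' Ww inner0r.
apply/funext => x; apply: xget_unique; first by split; [exact: defect|exact: PO].
move=> y [Wy yO]; apply/eqP; rewrite -subr_eq0; apply/eqP.
have d w : W w -> inner (y - P x) w = 0.
  move=> Ww; have -> : y - P x = (x - P x) - (x - y).
    by rewrite (opprB x y) [RHS]addrC subrKA.
  by rewrite innerBl (PO _ _ Ww) (yO _ Ww) subrr.
apply: inner_inj => z; rewrite inner0l.
have nd : nrm (y - P x) ^+ 2 = 0.
  by rewrite -rdotxx /rdot innerBr !d ?subrr//; exact: defect.
by move/eqP: nd; rewrite sqrf_eq0 => /eqP/nrm0_eq0 ->; rewrite inner0l.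
Qed.

Let evT x z := P (res z x).

Let bP : bounded_operator P.
Proof.
have := bounded_id_sub 1 (bounded_comp bT bL); congr bounded_operator.
by apply/funext => x; rewrite scale1r.
Qed.

Let resP z : Omega z -> op_inverse (fun x => x - z *: L x) (res z).
Proof. by move=> Oz; apply/inv_opP/resolvent_invertible. Qed.

(** [(I - z L)^-1 T x = T x + z (I - z L)^-1 x], and the projection
    annihilates the range of [T]. *)
Lemma shimorin_shift x z : Omega z -> evT (T x) z = z *: evT x z.
Proof.
move=> Oz; have [_ rK Kr] := resP Oz; have [lL _] := bL; have [lP _] := bP.
rewrite /evT; have -> : res z (T x) = T x + z *: res z x.
  rewrite -[RHS]rK; congr (res z).
  rewrite (linD lL) TL (linZ lL) scalerDr opprD addrACA -scalerBr Kr.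
  by rewrite subrK.
by rewrite (linD lP) (linZ lP) {1}/P TL subrr add0r.
Qed.

Let Omega0 : Omega 0.
Proof. by rewrite /Omega /disc_of_inv_radius /= normr0 mulr0. Qed.

Lemma shimorin_analytic x : analytic_on Omega (evT x).
Proof.
move=> a Oa; apply: (resolvent_analytic x bL bP).
exact: resolvent_invertible.
Qed.

Let res0 x : res 0 x = x.
Proof. by have [_ + _] := resP Omega0 => /(_ x); rewrite scale0r subr0. Qed.

(** If the function of [x] vanishes then [x = T (L x)], and the function of
    [L x] vanishes off the origin, hence also there by continuity; iterating,
    [x] lies in the range of every power of [T]. *)
Lemma shimorin_inj x : (forall x, (forall n, exists y, x = iter n T y) -> x = 0) ->
  (forall z, Omega z -> evT x z = 0) -> x = 0.
Proof.
move=> Tana fx0.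
have step y : (forall z, Omega z -> evT y z = 0) ->
    y = T (L y) /\ forall z, Omega z -> evT (L y) z = 0.
  move=> fy0; have yE : y = T (L y).
    by have := fy0 0 Omega0; rewrite /evT res0 => /eqP; rewrite subr_eq0 => /eqP.
  have fz z : Omega z -> z != 0 -> evT (L y) z = 0.
    move=> Oz z0; have := fy0 z Oz; rewrite {1}yE shimorin_shift// => /eqP.
    by rewrite scaler_eq0 (negbTE z0) => /eqP.
  split=> // z Oz; have [->|] := eqVneq z 0; last exact: fz.
  have [|r r0 f0] := analytic_flat (shimorin_analytic (L y)) Omega0.
    move=> m e e0; pose rho := spectral_radius L.
    have rho1 : 0 < `|rho| + 1 by rewrite ltr_wpDl.
    pose d := Num.min e (`|rho| + 1)^-1.
    have d0 : 0 < d by rewrite lt_min e0 invr_gt0.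
    have nd : nrm (d / 2)%:C = d / 2 by rewrite nrmR gtr0_norm ?divr_gt0.
    have d2 : d / 2 < d by lra.
    have dN0 : (d / 2)%:C != 0 :> R[i].
      by rewrite -(rmorph0 (real_complex R)) (inj_eq (@complexI R)) gt_eqF ?divr_gt0.
    exists (d / 2)%:C; split.
    - exact: dN0.
    - by rewrite nd (lt_le_trans d2)// ge_min lexx.
    - rewrite add0r fz ?nrm0 ?mulr_ge0 ?exprn_ge0 ?nrm_ge0 ?(ltW e0)//.
        rewrite /Omega /disc_of_inv_radius /= nrmE -rmorphM /= nd.
        rewrite -(rmorph1 (real_complex R)) ltcR -/rho.
        have h1 : (`|rho| + 1) * d <= 1.
          by rewrite -ler_pdivlMl// mulr1 ge_min lexx orbT.
        have h2 : rho * (d / 2) <= `|rho| * (d / 2).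
          by rewrite ler_wpM2r ?ler_norm// divr_ge0 ?ltW.
        by apply: (le_lt_trans h2); nra.
  by rewrite -(addr0 0) f0 ?nrm0.
apply: Tana => n; exists (iter n L x).
suff [] : x = iter n T (iter n L x) /\
    forall z, Omega z -> evT (iter n L x) z = 0 by [].
elim: n => [//|n [IHn /step[LnE Ln0]]]; split=> //.
by rewrite iterSr -[T _]LnE.
Qed.

(** The kernel function of [eta] at [w] is the adjoint of the resolvent applied
    to [eta]: pairing with it moves the resolvent to the other side, and the
    projection can be inserted because [eta] lies in [W]. *)
Lemma shimorin_rkhs :
  (forall x, (forall n, exists y, x = iter n T y) -> x = 0) ->
  is_rkhs Omega W (resolvent_kernel L W) evT.
Proof.
move=> Tana; have [lP _] := bP; split.
- move=> z Oz a x y; have [[lr _] _ _] := resP Oz.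
  by rewrite /evT lr lP.
- by move=> x; exact: shimorin_inj.
- by move=> x z _; exact: defect.
- exact: shimorin_analytic.
- move=> w eta Ow Weta; have [bL' LL'] := adj_opP bL.
  have [br rK Kr] := resP Ow; have [br' rr'] := adj_opP br.
  have inv' := op_inverse_adjoint (resP Ow) br' (adjoint_id_sub w LL') rr'.
  exists (adj_op (res w) eta) => [z Oz|f].
    by rewrite /resolvent_kernel /= shimorin_proj (inv_op_eq inv').
  by rewrite -rr' /evT innerBl TT' Weta inner0r subr0.
Qed.

End ShimorinModel.

(** The operator is conjugated by the unitary operator between the two
    realizations, which does not change the functions. *)
Lemma shift_transport (R : realType) (E H1 H2 : hilbertType R) (Omega : set R[i])
    (F : set E) (k : R[i] -> R[i] -> E -> E) (ev1 : H1 -> R[i] -> E)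
    (ev2 : H2 -> R[i] -> E) (T : H1 -> H1) :
  is_rkhs Omega F k ev1 -> is_rkhs Omega F k ev2 -> is_shift Omega ev1 T ->
  exists2 S : H2 -> H2, is_shift Omega ev2 S & unitarily_equivalent T S.
Proof.
move=> K1 K2 [bT Tz]; have [V uV VE] := rkhs_unitary K1 K2.
have [bV Vinner /choice[V' VV']] := uV; have [lV _] := bV.
have Vn x : nrm (V x) = nrm x.
  have := Vinner x x; rewrite !inner_nrm => /(@complexI R)/eqP.
  by rewrite eqrXn2 ?nrm_ge0// => /eqP.
have Vinj : injective V.
  by apply: (lin_inj lV) => x Vx0; apply: nrm0_eq0; rewrite -Vn Vx0 nrm0.
have bV' : bounded_operator V'.
  apply/bounded_operatorP; split.
    by move=> a x y; apply: Vinj; rewrite lV !VV'.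
  by exists 1 => // x; rewrite mul1r -Vn VV'.
exists (V \o T \o V').
  split; first by apply: bounded_comp => //; exact: bounded_comp.
  by move=> f z Oz; rewrite /= VE// Tz// -VE// VV'.
by exists V => //; apply/funext => x /=; congr (V (T _)); apply: Vinj; rewrite VV'.
Qed.

(** * The Aluthge transform *)

Section Aluthge.
Context {R : realType} {H : hilbertType R} (T : H -> H).
Hypotheses (bT : bounded_operator T) (iT : left_invertible T).

Let T' := adj_op T.
Let A := abs_op T.
Let B := sqrt_op A.

Let bT' : bounded_operator T'. Proof. by have [] := adj_opP bT. Qed.
Let TT' : adjoint T T'. Proof. by have [] := adj_opP bT. Qed.

Lemma left_invertible_below :
  exists2 c : R, 0 < c & forall x, c * nrm x <= nrm (T x).
Proof.
have [X /bounded_operatorP[_ [M M0 XM]] TX] := iT.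
exists M^-1; first by rewrite invr_gt0.
by move=> x; rewrite ler_pdivrMl// -{1}(TX x).
Qed.

Lemma conj_coercive C : coercive C -> coercive (T' \o C \o T).
Proof.
by move=> cC; have [c c0 Tc] := left_invertible_below; exact: coercive_conj Tc.
Qed.

Lemma abs_opP : coercive A /\ A \o A = T' \o T.
Proof. exact/sqrt_opP/(conj_coercive coercive_id). Qed.

Let cA : coercive A. Proof. by have [] := abs_opP. Qed.
Let AAE x : A (A x) = T' (T x).
Proof. by have [_ /(congr1 (@^~ x))] := abs_opP. Qed.
Let AA : adjoint A A. Proof. by have [/positive_adjoint] := cA. Qed.
Let Ai := inv_op A.
Let AiP : op_inverse A Ai. Proof. exact/inv_opP/coercive_invertible. Qed.
Let AK : cancel A Ai. Proof. by have [] := AiP. Qed.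
Let AiK : cancel Ai A. Proof. by have [] := AiP. Qed.

Let cB : coercive B. Proof. by have [] := sqrt_opP cA. Qed.
Let BBE x : B (B x) = A x.
Proof. by have [_ /(congr1 (@^~ x))] := sqrt_opP cA. Qed.
Let BB : adjoint B B. Proof. by have [/positive_adjoint] := cB. Qed.
Let bB : bounded_operator B. Proof. by have [[]] := cB. Qed.
Let Bi := inv_op B.
Let BiP : op_inverse B Bi. Proof. exact/inv_opP/coercive_invertible. Qed.
Let BK : cancel B Bi. Proof. by have [] := BiP. Qed.
Let BiK : cancel Bi B. Proof. by have [] := BiP. Qed.
Let bBi : bounded_operator Bi. Proof. by have [] := BiP. Qed.

(** [T A^-1] is isometric because [A^2 = T^* T]; it is the only candidate, [A]
    being onto. *)
Lemma polar_isometryE : polar_isometry T = T \o Ai.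
Proof.
have bAi : bounded_operator Ai by have [] := AiP.
have nU x : nrm (T (Ai x)) = nrm x.
  have : nrm (T (Ai x)) ^+ 2 == nrm x ^+ 2.
    by rewrite -!rdotxx /rdot TT' -AAE -AA AiK.
  by rewrite eqrXn2 ?nrm_ge0// => /eqP.
have [X _ TX] := iT; have [lT _] := bT.
apply: xget_unique.
- split.
  + split; first exact: bounded_comp.
    by move=> x _; rewrite nrmE nU -nrmE.
  + by apply/funext => x /=; rewrite AK.
  + apply/seteqP; split=> x; rewrite /ker /=.
      move=> Ux0; have -> : x = 0 by apply: nrm0_eq0; rewrite -nU Ux0 nrm0.
      exact: lin0 lT.
    move=> Tx0; have -> : x = 0 by rewrite -(TX x) Tx0 -{1}(lin0 lT) TX.
    by have [lAi _] := bAi; rewrite (lin0 lAi) (lin0 lT).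
- move=> U' [_ /(congr1 (fun f y => f (Ai y))) TU' _]; apply/funext => y.
  by have /= -> := congr1 (@^~ y) TU'; rewrite -/A AiK.
Qed.

(** Since [B] is a square root of [A], the factor [A^-1 B] in [B (T A^-1) B]
    is [B^-1]. *)
Lemma aluthgeE : aluthge T = B \o T \o Bi.
Proof.
rewrite /aluthge polar_isometryE; apply/funext => x /=; congr (B (T _)).
by rewrite -(AK (Bi x)) -BBE BiK.
Qed.

Lemma aluthge_bounded : bounded_operator (aluthge T).
Proof. by rewrite aluthgeE; do 2!apply: bounded_comp => //. Qed.

Lemma adj_aluthgeE : adj_op (aluthge T) = Bi \o T' \o B.
Proof.
have BiBi := adjoint_inverse BB BiP.
rewrite aluthgeE; apply: adj_op_eq; first by do 2!apply: bounded_comp => //.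
exact: (adjoint_comp (adjoint_comp BB TT') BiBi).
Qed.

Lemma aluthge_adjoint : adjoint (aluthge T) (adj_op (aluthge T)).
Proof. by have [] := adj_opP aluthge_bounded. Qed.

Lemma ker_adj_aluthge : ker (adj_op (aluthge T)) = Bi @` ker T'.
Proof.
have lBi : linear Bi by case: bBi.
rewrite adj_aluthgeE; apply/seteqP; split=> x; rewrite /ker /=.
  move=> x0; exists (B x); last exact: BK.
  by rewrite -[LHS]BiK x0 (lin0 (T := B)) //; case: bB.
by move=> [y y0 <-]; rewrite /= BiK y0 (lin0 lBi).
Qed.

Let D := T' \o A \o T.
Let Di := inv_op D.
Let DiP : op_inverse D Di.
Proof. exact/inv_opP/coercive_invertible/conj_coercive. Qed.

Let LT := shimorin_left_inverse T.

Let LTE : LT = Ai \o Ai \o T'.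
Proof.
rewrite /LT /shimorin_left_inverse; congr (_ \o _).
apply: inv_op_eq; have := op_inverse_comp AiP AiP.
by congr (op_inverse _ _); apply/funext => x /=; rewrite AAE.
Qed.

Let middleP : op_inverse (LT \o A \o T) (Di \o (A \o A)).
Proof.
have [[bA _] _] := cA; have [bAi _ _] := AiP.
have AAi : op_inverse (Ai \o Ai) (A \o A).
  by split=> [|x|x] /=; rewrite ?AiK ?AK//; exact: bounded_comp.
by rewrite LTE; exact: op_inverse_comp AAi DiP.
Qed.

Lemma middle_invertible : op_invertible (LT \o A \o T).
Proof. by exists (Di \o (A \o A)). Qed.

Let L := B \o (inv_op (LT \o A \o T) \o LT) \o B.

(** The factor [(T^* T)^-1 = A^-2] of the Shimorin left inverse of [T] cancels
    between the two factors in the middle. *)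
Let LE : L = B \o Di \o T' \o B.
Proof.
rewrite /L (inv_op_eq middleP) LTE; apply/funext => x /=.
by rewrite !AiK.
Qed.

Lemma model_bounded : bounded_operator L.
Proof. by rewrite LE; have [bDi _ _] := DiP; do 3!apply: bounded_comp => //. Qed.

Lemma model_left_inverse : cancel (aluthge T) L.
Proof.
move=> x; rewrite aluthgeE LE /= BBE; have [_ DK _] := DiP.
by rewrite -[T' _]/(D (Bi x)) DK BiK.
Qed.

(** With [model_left_inverse], this identifies [L] as the Shimorin left inverse
    of the Aluthge transform [S]: [x - S (L x)] is the component of [x]
    orthogonal to the range of [S]. *)
Lemma model_defect x : adj_op (aluthge T) (x - aluthge T (L x)) = 0.
Proof.
have [lB _] := bB; have [lT' _] := bT'; have [lBi _] := bBi.
have [_ _ DiK] := DiP.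
rewrite adj_aluthgeE aluthgeE LE /= BK (linB lB) BBE (linB lT').
by rewrite -[T' (A _)]/(D (Di _)) DiK subrr (lin0 lBi).
Qed.

Lemma iter_aluthge n x : iter n (aluthge T) x = B (iter n T (Bi x)).
Proof.
rewrite aluthgeE; elim: n => [|n IHn] /=; first by rewrite BiK.
by rewrite IHn BK.
Qed.

Lemma aluthge_analytic :
  (forall x, (forall n, exists y, x = iter n T y) -> x = 0) ->
  forall x, (forall n, exists y, x = iter n (aluthge T) y) -> x = 0.
Proof.
move=> Tana x xT; have lB : linear B by case: bB.
rewrite -(BiK x) (Tana (Bi x)) ?(lin0 lB)// => n.
by have [y ->] := xT n; exists (Bi y); rewrite iter_aluthge BK.
Qed.

End Aluthge.

Theorem theorem7p3 (R : realType) (E : hilbertType R)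
    (k : R[i] -> R[i] -> E -> E)
    (Hk : hilbertType R) (ev : Hk -> R[i] -> E) (Mz : Hk -> Hk) :
  analytic_kernel unit_disc k ->
  is_rkhs unit_disc setT k ev ->
  is_shift unit_disc ev Mz ->
  left_invertible Mz ->
  let absM := abs_op Mz in
  let LM := shimorin_left_inverse Mz in
  let L := sqrt_op absM \o (inv_op (LM \o absM \o Mz) \o LM) \o sqrt_op absM in
  let W := ker (adj_op (aluthge Mz)) in
  let Omega := disc_of_inv_radius (spectral_radius L) in
  let kt := resolvent_kernel L W in
  [/\ op_invertible (LM \o absM \o Mz),
      W = inv_op (sqrt_op absM) @` ker (adj_op Mz),
      (exists (Hkt : hilbertType R) (evt : Hkt -> R[i] -> Hk),
         is_rkhs Omega W kt evt)
    & forall (Hkt : hilbertType R) (evt : Hkt -> R[i] -> Hk),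
        is_rkhs Omega W kt evt ->
        exists2 S : Hkt -> Hkt, is_shift Omega evt S
                              & unitarily_equivalent (aluthge Mz) S].
Proof.
move=> _ K Mshift iM absM LM L W Omega kt.
have [bM _] := Mshift.
have bL := model_bounded bM iM.
have bA := aluthge_bounded bM iM.
have AA := aluthge_adjoint bM iM.
have AL := model_left_inverse bM iM.
have def := model_defect bM iM.
have Mana x : (forall n, exists y, x = iter n Mz y) -> x = 0.
  exact: shift_analytic K Mshift.
have model := shimorin_rkhs bA bL AA AL def (aluthge_analytic bM iM Mana).
have shift := shimorin_shift bA bL AL.
split.
- exact: middle_invertible.
- exact: ker_adj_aluthge.
- by eexists Hk, _; exact: model.
- move=> Hkt evt Kt; apply: shift_transport model Kt _; split; first exact: bA.
  by move=> x z; exact: shift.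
Qed.
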